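(* Let $p,q,\alpha,\beta\in(0,1)$. Let $(A_n)_{n\in\mathbb{Z}}$ be i.i.d. with distribution $\mathrm{Ber}(p)\mathrm{Geom}(\alpha)$ and let $(S_n)_{n\in\mathbb{Z}}$ be i.i.d. with distribution $\mathrm{Ber}(q)\mathrm{Geom}(\beta)$, the two sequences being independent of each other. Let $X_n$, $Y_n$, $D_n$ ($n\in\mathbb{Z}$) be the queue length before arrival, the queue length after arrival, and the departures of the discrete-time batch queue with arrival process $(A_n)$ and service process $(S_n)$ (defined in the context). Suppose that $p\beta<q\alpha$ and that $$\frac{\alpha}{1-\alpha}\,\frac{p}{1-p}=\frac{\beta}{1-\beta}\,\frac{q}{1-q}.$$ Then: (i) The processes $(X_n)_{n\in\mathbb{Z}}$ and $(Y_n)_{n\in\mathbb{Z}}$ are reversible; moreover they are jointly reversible in the sense that $$(\dots,X_{-1},Y_{-1},X_0,Y_0,X_1,Y_1,\dots)\stackrel{d}{=}(\dots,X_2,Y_1,X_1,Y_0,X_0,Y_{-1},\dots),$$ that is, $\big((X_n,Y_n)\big)_{n\in\mathbb{Z}}\stackrel{d}{=}\big((X_{1-n},Y_{-n})\big)_{n\in\mathbb{Z}}$. (ii) The departure process $(D_n)_{n\in\mathbb{Z}}$ has the same law as the arrival process $(A_n)_{n\in\mathbb{Z}}$. (iii) For every $n$, $X_n\sim\mathrm{Ber}(c)\mathrm{Geom}(\gamma)$, where $$c=\frac{\beta}{1-\beta}\,\frac{1-\alpha}{\alpha},\qquad \gamma=\frac{\alpha-\beta}{1-\beta},$$ and $Y_n\sim\mathrm{Ber}(p+c-pc)\mathrm{Geom}(\gamma)$.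 (iv) For every $n$, the queue length $X_n$ is independent of the process $(D_i)_{i<n}$ of departures before time $n$.
   Context: For $p\in[0,1]$ and $\alpha\in(0,1)$, a random variable $A$ has distribution $\mathrm{Ber}(p)\mathrm{Geom}(\alpha)$ if $\mathbb{P}(A=0)=1-p$ and $\mathbb{P}(A=k)=p\alpha(1-\alpha)^{k-1}$ for integers $k\ge1$. Its mean is $p/\alpha$. Batch queue: given arrivals $(A_n)_{n\in\mathbb{Z}}$ and services $(S_n)_{n\in\mathbb{Z}}$, set $$X_n=\max_{m\le n}\sum_{r=m}^{n-1}(A_r-S_r)$$ (maximum over integers $m\le n$, with an empty sum equal to $0$), which is almost surely finite when $\mathbb{E}A_n<\mathbb{E}S_n$ (here equivalent to $p\beta<q\alpha$), and satisfies $X_{n+1}=\max\{X_n+A_n-S_n,0\}$. Set $Y_n=X_n+A_n$ and $D_n=\min(Y_n,S_n)$. A process $(Z_n)_{n\in\mathbb{Z}}$ is reversible if $(Z_n)_{n\in\mathbb{Z}}\stackrel{d}{=}(Z_{-n})_{n\in\mathbb{Z}}$, where $\stackrel{d}{=}$ denotes equality in law. *)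

(* Defs.v *)
From HB Require Import structures.
From mathcomp Require Export all_boot all_order all_algebra.
From mathcomp Require Export all_classical all_reals all_analysis.
From mathcomp Require Export measurable_realfun.

Set Implicit Arguments.
Unset Strict Implicit.
Unset Printing Implicit Defensive.

Import Order.TTheory GRing.Theory Num.Theory.

Local Open Scope classical_set_scope.
Local Open Scope ring_scope.

(* A process indexed by I with state space E is a function Z : I -> T -> E;
   its sample path at w is trajectory Z w. *)
Definition trajectory (I T E : Type) (Z : I -> T -> E) (w : T) : I -> E :=
  fun i => Z i w.

(* The product sigma-algebra on I -> E, generated by the coordinates. *)
Definition cylinders (I : Type) (d : measure_display) (E : measurableType d) :
    set (set (I -> E)) :=
  [set C | exists (i : I) (B : set E),
     measurable B /\ C = (fun z : I -> E => z i) @^-1` B].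

Definition path_measurable (I : Type) (d : measure_display)
    (E : measurableType d) (C : set (I -> E)) : Prop :=
  <<s @cylinders I d E >> C.

(* Equality of the laws, on the product space, of two processes. *)
Definition same_law (d : measure_display) (T : measurableType d) (R : realType)
    (P : probability T R) (I : Type) (d' : measure_display)
    (E : measurableType d') (Z Z' : I -> T -> E) : Prop :=
  forall C : set (I -> E), path_measurable C ->
    P (trajectory Z @^-1` C) = P (trajectory Z' @^-1` C).

Definition reversible (d : measure_display) (T : measurableType d)
    (R : realType) (P : probability T R) (d' : measure_display)
    (E : measurableType d') (Z : int -> T -> E) : Prop :=
  same_law P Z (fun n : int => Z (- n)).

Definition mutually_independent (d : measure_display) (T : measurableType d)
    (R : realType) (P : probability T R) (I : choiceType)
    (d' : measure_display) (E : measurableType d') (Z : I -> T -> E) : Prop :=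
  forall (J : seq I) (B : I -> set E), uniq J ->
    (forall i, measurable (B i)) ->
    P (\bigcap_(i in [set` J]) (Z i @^-1` B i)) =
      (\prod_(i <- J) P (Z i @^-1` B i))%E.

Definition independent_processes (d : measure_display) (T : measurableType d)
    (R : realType) (P : probability T R) (I J : Type)
    (d1 d2 : measure_display) (E : measurableType d1) (F : measurableType d2)
    (Z : I -> T -> E) (W : J -> T -> F) : Prop :=
  forall (B : set (I -> E)) (C : set (J -> F)),
    path_measurable B -> path_measurable C ->
    P (trajectory Z @^-1` B `&` trajectory W @^-1` C) =
      (P (trajectory Z @^-1` B) * P (trajectory W @^-1` C))%E.

Definition independent_of_process (d : measure_display) (T : measurableType d)
    (R : realType) (P : probability T R) (J : Type)
    (d1 d2 : measure_display) (E : measurableType d1) (F : measurableType d2)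
    (U : T -> E) (W : J -> T -> F) : Prop :=
  forall (B : set E) (C : set (J -> F)),
    measurable B -> path_measurable C ->
    P (U @^-1` B `&` trajectory W @^-1` C) =
      (P (U @^-1` B) * P (trajectory W @^-1` C))%E.

(* Ber(p)Geom(a).  The variable may take the value +oo (see queue_length). *)
Definition has_BerGeom (d : measure_display) (T : measurableType d)
    (R : realType) (P : probability T R) (p a : R) (Z : T -> \bar R) : Prop :=
  [/\ 0 <= p <= 1,
      0 < a < 1,
      P [set w | Z w = 0%E] = (1 - p)%:E &
      forall k : nat, (1 <= k)%N ->
        P [set w | Z w = (k%:R)%:E] = (p * a * (1 - a) ^+ k.-1)%:E].

Section BatchQueue.
Context (T : Type) (R : realType) (A S : int -> T -> R).

(* The sum of A_r - S_r over m <= r <= n - 1, for m <= n. *)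
Definition net_input (m n : int) (w : T) : R :=
  \sum_(i < `|n - m|%N) (A (m + i%:Z) w - S (m + i%:Z) w).

(* X_n: the maximum is taken as a supremum in \bar R, so that X_n is +oo on
   the null event where the partial sums are unbounded.  For integer-valued
   A and S, a finite supremum is attained. *)
Definition queue_length (n : int) (w : T) : \bar R :=
  ereal_sup [set (net_input m n w)%:E | m in [set m : int | m <= n]].

Definition queue_after_arrival (n : int) (w : T) : \bar R :=
  (queue_length n w + (A n w)%:E)%E.

Definition departures (n : int) (w : T) : \bar R :=
  Order.min (queue_after_arrival n w) (S n w)%:E.

End BatchQueue.

(* Main.v *)
(* Read in half steps, (X_n, Y_n) is a Markov chain on the natural numbers which
   alternately adds an arrival and removes a service.  Under the balance
   condition its two transition kernels satisfy detailed balance with respect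
   to the laws Ber(c)Geom(gamma) of X_n and Ber(p+c-pc)Geom(gamma) of Y_n, so
   the probability of a finite path equals that of the reversed path.  Joint
   reversibility follows, and so does, by induction on the length of the path,
   the product form of the joint law of X_n and the departures before n.

   It remains to see that X_n, the increasing limit of queues started empty in
   the remote past, is finite and has law Ber(c)Geom(gamma).  Its tail
   G k = P(X_n >= k) is at most the tail of Ber(c)Geom(gamma), by monotonicity
   of the one-step operator, and the difference of the two is a nonnegative
   harmonic function that vanishes at 0 and tends to 0 at infinity: it is zero
   by the maximum principle. *)
Require Import Defs.
From mathcomp Require Import all_boot all_order all_algebra.
From mathcomp Require Import all_classical all_reals all_analysis.
From mathcomp Require Import measurable_realfun.
From mathcomp Require Import zify ring lra.

Set Implicit Arguments.
Unset Strict Implicit.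
Unset Printing Implicit Defensive.

Import Order.TTheory GRing.Theory Num.Theory.
Import numFieldNormedType.Exports.

Local Open Scope classical_set_scope.
Local Open Scope ring_scope.

(** * Laws of discrete processes *)

(** Two gaps separate the chain from the statement. The inputs are real variables that are natural
    numbers only almost surely, and the queue length may be infinite on a null event; the argument
    therefore runs on truncated inputs and a queue in [nat], and returns through identities valid at
    all times at once off a null event. Moreover the queue is a prescribed function of the inputs,
    not a chain launched from its invariant law, so invariance of Ber(c)Geom(gamma) does not by
    itself give the law of X_n; the domination of tails supplies the decay at infinity that the
    maximum principle requires.

    The work is done with [r = 1 - gamma = (1 - alpha) / (1 - beta)], the ratio of the geometric
    tails. Detailed balance forces it: an arrival of size k + 1 carries [(1 - alpha)^k], the
    opposite service [(1 - beta)^k], and the invariant weights make up the factor [r^k]. With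
    [c' = p + c - p c], the condition on the odds becomes [c' q = p].

    Since the state spaces are countable, a law on path space is determined by finite windows of
    fixed values. *)

Lemma total_probability (d : measure_display) (T : measurableType d)
    (R : realType) (mu : probability T R) (V : T -> nat) (E : set T) :
  measurable_fun setT V -> measurable E ->
  mu E = (\sum_(0 <= k <oo) mu (E `&` V @^-1` [set k]))%E.
Proof.
move=> mV mE.
have mEV k : measurable (E `&` V @^-1` [set k]).
  by apply: measurableI => //; rewrite -[X in measurable X]setTI; exact: mV.
rewrite -(measure_semi_bigcup mu mEV).
- by congr (mu _); apply/seteqP; split => [w Ew|w [k _ []]//]; exists (V w).
- apply/trivIsetP => i j _ _ /eqP ij; apply/seteqP; split => // w [[_ Vi] [_ Vj]].
  by case: ij; rewrite -Vi -Vj.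
- exact: bigcupT_measurable.
Qed.

Section DiscreteProcess.
Context (d : measure_display) (T : measurableType d) (R : realType).
Context (mu nu : {measure set T -> \bar R}).
Context (mu_fin : (mu setT < +oo)%E) (mu_nu : mu setT = nu setT).
Context (I : choiceType) (K : countType) (J : nat -> seq I).
Context (J_mono : forall m n, (m <= n)%N -> {subset J m <= J n})
  (J_full : forall i, exists n, i \in J n).
Context (z z' : I -> T -> K)
  (mz : forall i k, measurable (z i @^-1` [set k]))
  (mz' : forall i k, measurable (z' i @^-1` [set k])).

Definition window (n : nat) (v : I -> K) : set (I -> K) :=
  [set x | forall i, i \in J n -> x i = v i].

(* The index sets [J n] are nested, so that two windows are disjoint or meet in the
   finer one. *)
Definition windows : set (set (I -> K)) :=
  [set C | C = set0 \/ exists n v, C = window n v].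

Lemma windows_setI : setI_closed windows.
Proof.
move=> C D [->|[m [v ->]]]; first by rewrite set0I; left.
move=> [->|[n [u ->]]]; first by rewrite setI0; left.
have [->|] := eqVneq (window m v `&` window n u) set0; first by left.
move=> /set0P[x [xm xn]]; right; exists (maxn m n), x.
apply/seteqP; split => y /=.
  move=> [ym yn] i; case: (leqP m n) => mn iJ.
    by rewrite yn // xn.
  by rewrite ym // xm.
move=> yx; split=> i iJ.
  by rewrite yx ?xm //; apply: J_mono iJ; exact: leq_maxl.
by rewrite yx ?xn //; apply: J_mono iJ; exact: leq_maxr.
Qed.

Lemma measurable_window (y : I -> T -> K) n v :
  (forall i k, measurable (y i @^-1` [set k])) ->
  measurable (trajectory y @^-1` window n v).
Proof.
move=> my; rewrite (_ : _ @^-1` _ =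
   \big[setI/setT]_(i <- J n) (y i @^-1` [set v i])).
  by apply: bigsetI_measurable => i _; exact: my.
rewrite -bigcap_seq; apply/seteqP; split => w /= wJ i iJ; exact: wJ.
Qed.

(** Dynkin's pi-lambda theorem: the windows and the empty set form a pi-system, and the sets of
    equal measure form a Dynkin class because the total masses are finite and equal. Measurability
    of both preimages is carried along in the class. *)
Lemma sigma_windows_eq (C : set (I -> K)) :
  (forall n v, mu (trajectory z @^-1` window n v) =
               nu (trajectory z' @^-1` window n v)) ->
  <<s windows >> C ->
  mu (trajectory z @^-1` C) = nu (trajectory z' @^-1` C).
Proof.
move=> eq_win.
suff : <<s windows >> `<=` [set C |
    [/\ measurable (trajectory z @^-1` C), measurable (trajectory z' @^-1` C) &
        mu (trajectory z @^-1` C) = nu (trajectory z' @^-1` C)]].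
  by move=> + /[dup] CG => /[apply] -[].
rewrite -setI_closed_g_dynkin_g_sigma_algebra; last exact: windows_setI.
apply: smallest_sub; last first.
  move=> D [->|[n [v ->]]] /=; first by rewrite !preimage_set0 !measure0.
  by split; [exact: measurable_window|exact: measurable_window|].
split.
- by split; rewrite ?preimage_setT.
- move=> D [mD mD' eqD].
  split; [exact: measurableC mD|exact: measurableC mD'|].
  have compl (m : {measure set T -> \bar R}) E : (m setT < +oo)%E ->
      measurable E -> m (~` E) = (m setT - m E)%E.
    by move=> mfin mE; rewrite -setTD measureD ?setTI.
  transitivity (mu setT - mu (trajectory z @^-1` D))%E; first exact: compl mD.
  by rewrite eqD mu_nu; apply/esym/compl => //; rewrite -mu_nu.
- move=> F tF mF.
  have pre (y : I -> T -> K) :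
      trajectory y @^-1` (\bigcup_n F n) = \bigcup_n trajectory y @^-1` F n.
    exact: preimage_bigcup.
  rewrite /= !pre.
  have tr (y : I -> T -> K) : trivIset setT (fun n => trajectory y @^-1` F n).
    apply/trivIsetP => i j _ _ ij; rewrite -preimage_setI.
    by move/trivIsetP : tF => /(_ i j) ->; rewrite ?preimage_set0.
  have m1 : measurable (\bigcup_n trajectory z @^-1` F n).
    by apply: bigcupT_measurable => n; have [] := mF n.
  have m2 : measurable (\bigcup_n trajectory z' @^-1` F n).
    by apply: bigcupT_measurable => n; have [] := mF n.
  split => //; rewrite !measure_semi_bigcup //.
  + by apply: eq_eseriesr => n _; have [] := mF n.
  + by move=> n; have [] := mF n.
  + by move=> n; have [] := mF n.
Qed.

(** A window has only countably many possible value lists, so the condition on one coordinate is a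
    countable union of windows, indexed here by the codes of the lists. *)
Lemma sigma_windows_coord i (B : set K) : <<s windows >> [set x | B (x i)].
Proof.
have [n iJ] := J_full i.
have [U0 _ U] := @smallest_sigma_algebra _ setT windows.
case: (pselect (exists k, B k)) => [[k0 _]|nB]; last first.
  rewrite (_ : [set x | _] = set0) //.
  by apply/seteqP; split => // x Bx; apply: nB; exists (x i).
(* [v l] is the path whose values on [J n] are listed in [l]; the default [k0] matters only off the
   window or for lists that are too short. *)
pose v l j := nth k0 l (index j (J n)).
pose F m : set (I -> K) :=
  if (unpickle m : option (seq K)) is Some l then
    if `[< B (v l i) >] then window n (v l) else set0
  else set0.
rewrite (_ : [set x | _] = \bigcup_m F m).
  apply: U => m; rewrite /F; case: (unpickle m) => [l|]; last exact: U0.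
  case: asboolP => // _; apply: sub_sigma_algebra; right; by exists n, (v l).
apply/seteqP; split => [x /= Bx|x [m _]].
  have vx j : j \in J n -> v (map x (J n)) j = x j.
    by move=> jJ; rewrite /v (nth_map j) ?index_mem // nth_index.
  exists (pickle (map x (J n))) => //; rewrite /F pickleK vx //.
  by case: asboolP => // _ j /vx ->.
by rewrite /F; case: (unpickle m) => // l; case: asboolP => // Bv /= ->.
Qed.

(** Two measures are allowed instead of one probability because independence will be the case of a
    restriction of P against a multiple of P. The map [e] embeds the discrete states in the actual
    state space. *)
Lemma discrete_law (d' : measure_display) (E : measurableType d') (e : K -> E)
    (C : set (I -> E)) :
  (forall n v, mu (trajectory z @^-1` window n v) =
               nu (trajectory z' @^-1` window n v)) ->
  path_measurable C ->
  mu [set w | C (fun i => e (z i w))] = nu [set w | C (fun i => e (z' i w))].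
Proof.
move=> eq_win mC.
suff /(sigma_windows_eq eq_win) : <<s windows >> [set x : I -> K | C (e \o x)] by [].
suff : @path_measurable I d' E `<=`
    [set D | <<s windows >> [set x : I -> K | D (e \o x)]].
  by apply.
have [U0 UC U] := @smallest_sigma_algebra _ setT windows.
apply: smallest_sub => [|D [i [B [mB ->]]] /=].
- by split=> [|D /UC //|F mF]; [exact: U0|exact: U mF].
- exact: sigma_windows_coord i (e @^-1` B).
Qed.

End DiscreteProcess.

(** * Bernoulli-geometric weights and their kernels *)

Lemma nneseries_telescope (R : realType) (f g : nat -> R) (l : R) :
  (forall n, f n = g n - g n.+1) -> g @ \oo --> l ->
  (\sum_(0 <= n <oo) (f n)%:E = (g 0%N - l)%:E)%E.
Proof.
move=> fg gl; apply/cvg_lim => //.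
rewrite (_ : (fun _ => _) = EFin \o (fun n => g 0%N - g n)).
  by apply: cvg_EFin; [exact: nearW|apply: cvgB => //; exact: cvg_cst].
apply/funext => n /=; rewrite sumEFin; congr EFin.
elim: n => [|n IH]; first by rewrite big_geq // subrr.
by rewrite big_nat_recr //= IH fg addrA subrK.
Qed.

Lemma average_le (R : realType) (w : nat -> R) (f : nat -> \bar R) (M : R) :
  (forall k, 0 <= w k) -> (\sum_(0 <= k <oo) (w k)%:E = 1)%E ->
  (forall k, 0 <= f k)%E -> (forall k, f k <= M%:E)%E ->
  (\sum_(0 <= k <oo) (w k)%:E * f k <= M%:E)%E.
Proof.
move=> w0 w1 f0 fM.
rewrite -[leRHS]mule1 -w1 -nneseriesZl; last by move=> i _; rewrite lee_fin.
apply: lee_nneseries => [i _ _|i _]; first by rewrite mule_ge0 ?lee_fin.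
by rewrite muleC lee_wpmul2r ?lee_fin.
Qed.

Lemma average_lt (R : realType) (w : nat -> R) (f : nat -> \bar R) (M : R) k0 :
  (forall k, 0 <= w k) -> (\sum_(0 <= k <oo) (w k)%:E = 1)%E ->
  (forall k, 0 <= f k)%E -> (forall k, f k <= M%:E)%E ->
  0 < w k0 -> (f k0 < M%:E)%E ->
  (\sum_(0 <= k <oo) (w k)%:E * f k < M%:E)%E.
Proof.
move=> w0 w1 f0 fM wk0 fk0.
have f_fin : f k0 \is a fin_num.
  by rewrite ge0_fin_numE // (lt_trans fk0) // ltry.
have wf0 k : (0 <= (w k)%:E * f k)%E by rewrite mule_ge0 ?lee_fin.
have M0 : 0 <= M by rewrite -lee_fin (le_trans (f0 0%N)).
have wM0 k : (0 <= M%:E * (w k)%:E)%E by rewrite mule_ge0 ?lee_fin.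
have M1 : (\sum_(0 <= k <oo) M%:E * (w k)%:E = M%:E)%E.
  by rewrite nneseriesZl ?w1 ?mule1 // => i _; rewrite lee_fin.
have tail0 (h : nat -> \bar R) : (forall k, 0 <= h k)%E ->
    (0 <= \sum_(0 <= k <oo | true && (k != k0)) h k)%E.
  by move=> h0; apply: nneseries_ge0.
have le_tail : (\sum_(0 <= k <oo | true && (k != k0)) (w k)%:E * f k <=
                \sum_(0 <= k <oo | true && (k != k0)) M%:E * (w k)%:E)%E.
  by apply: lee_nneseries => [//|n _]; rewrite muleC lee_wpmul2r ?lee_fin.
(* The term [k0] is split off both series; the remainder on the left must be finite for the strict
   inequality to survive the addition. *)
rewrite -[ltRHS]M1 (@nneseriesD1 _ _ k0) // [ltRHS](@nneseriesD1 _ _ k0) //.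
apply: lte_leD => //.
  rewrite ge0_fin_numE ?tail0 //; apply: le_lt_trans le_tail _.
  apply: (@le_lt_trans _ _ M%:E); last exact: ltry.
  by rewrite -[leRHS]M1 [leRHS](@nneseriesD1 _ _ k0) // leeDr.
by rewrite muleC lte_pmul2r.
Qed.

Section BernoulliGeometric.
Context {R : realType}.
Implicit Types p a : R.

Definition bergeom p a (k : nat) : R :=
  if k is j.+1 then p * a * (1 - a) ^+ j else 1 - p.

Definition bergeom_tail p a (k : nat) : R :=
  if k is j.+1 then p * (1 - a) ^+ j else 1.

Lemma bergeom_ge0 p a k : 0 <= p <= 1 -> 0 < a < 1 -> 0 <= bergeom p a k.
Proof.
move=> hp ha; case: k => [|k] /=; first lra.
by rewrite !mulr_ge0 ?exprn_ge0 //; lra.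
Qed.

Lemma bergeomE p a k :
  bergeom p a k = bergeom_tail p a k - bergeom_tail p a k.+1.
Proof.
case: k => [|k] /=; first by rewrite expr0 mulr1.
by rewrite exprS; ring.
Qed.

Lemma cvg_bergeom_tail p a : 0 < a < 1 -> bergeom_tail p a @ \oo --> 0.
Proof.
move=> ha; rewrite -(cvg_shiftS (bergeom_tail p a)) /=.
by apply: cvg_geometric; rewrite ger0_norm; lra.
Qed.

Lemma bergeom_tail_sum p a y : 0 < a < 1 ->
  (\sum_(0 <= k <oo) (if (y <= k)%N then bergeom p a k else 0)%:E =
   (bergeom_tail p a y)%:E)%E.
Proof.
move=> ha.
(* [maxn y k] freezes the tail below [y], so that the terms there vanish. *)
rewrite (@nneseries_telescope _ _ (fun k => bergeom_tail p a (maxn y k)) 0).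
- by rewrite maxn0 subr0.
- move=> k; case: leqP => ky; last by rewrite !(maxn_idPl _) ?subrr // ltnW.
  by rewrite !(maxn_idPr _) ?bergeomE // leqW.
- have := cvg_bergeom_tail p ha; rewrite -(cvg_shiftn y) => h.
  rewrite -(cvg_shiftn y); apply: cvg_trans h; apply: near_eq_cvg.
  by apply: nearW => n /=; rewrite (maxn_idPr _) // leq_addl.
Qed.

Lemma bergeom_sum p a : 0 < a < 1 ->
  (\sum_(0 <= k <oo) (bergeom p a k)%:E = 1)%E.
Proof. by move=> ha; rewrite -(bergeom_tail_sum p 0 ha). Qed.

End BernoulliGeometric.

(** * Half-step transition kernels and their invariant laws *)

Section QueueKernels.
Context {R : realType} {p q alpha beta c r : R}.
Local Notation c' := (p + c - p * c).
Context (hp : 0 < p < 1) (hq : 0 < q < 1) (halpha : 0 < alpha < 1)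
  (hbeta : 0 < beta < 1) (hc : 0 < c < 1) (hr : 0 < r < 1).
Context (c'q : c' * q = p) (c_alpha : c * alpha = beta * r)
  (cN_alpha : (1 - c) * alpha = 1 - r) (r_beta : (1 - beta) * r = 1 - alpha).

Definition arrival_kernel (x y : nat) : R :=
  if (x <= y)%N then bergeom p alpha (y - x) else 0.

(** Every service of size at least [y] empties the queue, hence a tail instead of a point mass at
    [x = 0]. *)
Definition service_kernel (y x : nat) : R :=
  if x is 0 then bergeom_tail q beta y
  else if (x <= y)%N then bergeom q beta (y - x) else 0.

(** [r_beta] matches the geometric rates and [c'q] the Bernoulli factors. The remaining constants
    agree by [c_alpha] when [0 < x < y], by [cN_alpha] at the boundary [x = 0 < y]; on the diagonal
    [x = y > 0] the identity is [c (1 - p) = c' (1 - q)]. *)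
Lemma detailed_balance x y :
  bergeom c (1 - r) x * arrival_kernel x y =
  bergeom c' (1 - r) y * service_kernel y x.
Proof.
have r_beta_n n : (1 - alpha) ^+ n = (1 - beta) ^+ n * r ^+ n.
  by rewrite -exprMn r_beta.
have E : 1 - (1 - r) = r by ring.
rewrite /arrival_kernel /service_kernel; case: x => [|x]; case: y => [|y] //=.
- ring.
- rewrite E r_beta_n -cN_alpha -[in LHS]c'q.
  by move: (_ ^+ y) (r ^+ y) => u v; ring.
- by rewrite !mulr0.
rewrite ltnS subSS; case: leqP => xy; last by rewrite !mulr0.
rewrite -(subnK xy); move: (y - x)%N => k; rewrite addnK E.
case: k => [|k] /=.
  have c1p : c * (1 - p) = c' * (1 - q) by rewrite [RHS]mulrBr c'q; ring.
  rewrite add0n; move: (r ^+ x) => v.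
  transitivity (c * (1 - p) * ((1 - r) * v)); first by ring.
  by rewrite c1p; ring.
rewrite r_beta_n addSn exprS exprD.
have -> : p * alpha = c' * (q * alpha) by rewrite -[in LHS]c'q; ring.
have -> : c * (1 - r) * r ^+ x * (c' * (q * alpha) * ((1 - beta) ^+ k * r ^+ k))
   = (c * alpha) * (1 - r) * r ^+ x * (c' * q * ((1 - beta) ^+ k * r ^+ k)).
  by move: (_ ^+ k) (r ^+ k) (r ^+ x) => u v w; ring.
rewrite c_alpha; move: (_ ^+ k) (r ^+ k) (r ^+ x) => u v w; ring.
Qed.

(** The arrival half of stationarity; composed with [service_tail] it makes the tail of Ber(c)Geom(1
    - r) a fixed point of the one-step operator. Tails are used because the queues started empty
    increase, so that their tails converge monotonically. *)
Lemma arrival_tail j :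
  (\sum_(0 <= u <oo) (bergeom p alpha u)%:E * (bergeom_tail c (1 - r) (j - u))%:E
   = (bergeom_tail c' (1 - r) j)%:E)%E.
Proof.
have E : 1 - (1 - r) = r by ring.
have [p0 a0 a1 r0 r1] : [/\ 0 <= p, 0 <= 1 - alpha, `|1 - alpha| < 1, 0 <= r & r <= 1].
  move: hp halpha hr => /andP[/ltW ? _] /andP[? /ltW ?] /andP[/ltW ? /ltW ?].
  by split; rewrite ?ger0_norm ?subr_ge0 // gtrDl oppr_lt0.
(* [g u] is the part of the sum with [A >= u]; given [A >= u], [A] is memoryless. *)
pose g u := if u is v.+1 then p * (1 - alpha) ^+ v * r ^+ (j - u)
            else bergeom_tail c' (1 - r) j.
rewrite (@nneseries_telescope _ _ g 0) ?subr0 //.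
- move=> [|u]; rewrite /g {g} /=.
    rewrite subn0 expr0 mulr1; case: j => [|j] /=; first by rewrite expr0; ring.
    by rewrite E subSS subn0; move: (r ^+ j) => v; ring.
  rewrite (subnS j u.+1); case: (j - u.+1)%N => [|k] /=.
    by rewrite expr0 exprS; move: (_ ^+ u) => v; ring.
  rewrite E !exprS; move: (_ ^+ u) (r ^+ k) => v w.
  transitivity (p * v * (c * alpha) * w); first by ring.
  have -> : c * alpha = r - (1 - alpha).
    by apply: (addIr ((1 - c) * alpha)); rewrite {2}cN_alpha; ring.
  by ring.
rewrite -(cvg_shiftS g).
apply: (@squeeze_cvgr _ _ _ _ (fun=> 0) (fun u => p * (1 - alpha) ^+ u)).
- apply: nearW => u /=.
  have pu0 : 0 <= p * (1 - alpha) ^+ u by rewrite mulr_ge0 ?exprn_ge0.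
  by rewrite mulr_ge0 ?exprn_ge0 // ler_piMr // exprn_ile1.
- exact: cvg_cst.
- exact: cvg_geometric.
Qed.

Lemma service_tail k :
  (\sum_(0 <= v <oo) (bergeom q beta v)%:E * (bergeom_tail c' (1 - r) (k.+1 + v))%:E
   = (bergeom_tail c (1 - r) k.+1)%:E)%E.
Proof.
have E : 1 - (1 - r) = r by ring.
have alpha0 : alpha != 0 by case/andP: halpha => /lt0r_neq0.
have a1 : `|1 - alpha| < 1.
  by case/andP: halpha => ? /ltW ?; rewrite ger0_norm ?subr_ge0 // gtrDl oppr_lt0.
(* [g v] is the part of the sum with service at least [v], a geometric series of ratio
   [(1 - beta) r = 1 - alpha]; hence the division by [alpha]. *)
pose g v := if v is u.+1 then c' * q * beta * r ^+ k.+1 / alpha * (1 - alpha) ^+ u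
            else bergeom_tail c (1 - r) k.+1.
rewrite (@nneseries_telescope _ _ g 0) ?subr0 //.
- move=> [|v]; rewrite /g {g} /= E.
    rewrite addn0 expr0 mulr1 exprS; move: (r ^+ k) => w.
    transitivity ((c' - c' * q) * w); first by ring.
    rewrite !c'q; transitivity (c * w - p * (beta * r) * w / alpha).
      by rewrite -c_alpha; field.
    by ring.
  rewrite addnS !exprS exprD.
  have -> : (1 - alpha) ^+ v = (1 - beta) ^+ v * r ^+ v by rewrite -r_beta exprMn.
  move: (_ ^+ v) (r ^+ v) (r ^+ k) => x y z.
  by field.
rewrite -(cvg_shiftS g).
exact: cvg_geometric.
Qed.

End QueueKernels.

(* Maximum principle: at a maximum [d] would be a strict average of values
   including [d 0 = 0]. *)
Lemma harmonic_eq0 (R : realType) (wa wb d : nat -> R) :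
  (forall k, 0 < wa k) -> (\sum_(0 <= k <oo) (wa k)%:E = 1)%E ->
  (forall k, 0 <= wb k) -> (\sum_(0 <= k <oo) (wb k)%:E = 1)%E -> 0 < wb 0%N ->
  (forall k, 0 <= d k) -> d 0%N = 0 -> d @ \oo --> 0 ->
  (forall k, (d k.+1)%:E = \sum_(0 <= v <oo) (wb v)%:E *
     \sum_(0 <= u <oo) (wa u)%:E * (d (k.+1 + v - u)%N)%:E)%E ->
  forall k, d k = 0.
Proof.
move=> wa0 wa1 wb0 wb1 wb00 d0 dz dcvg dE k0.
apply/eqP; apply: contraT => dk0; have dk0_gt : 0 < d k0 by rewrite lt_def dk0 d0.
have [N _ dN] : \forall n \near \oo, d n < d k0 by move: dcvg => /cvgr_lt; apply.
have k0N : (k0 < N)%N.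
  by rewrite ltnNge; apply/negP => /dN /=; rewrite ltxx.
case: (@Order.TotalTheory.arg_maxP _ _ _ (Ordinal k0N) xpredT
        (fun i : 'I_N => d i) isT) => -[k kN] _ kmax.
have dk n : d n <= d k.
  case: (ltnP n N) => nN; first exact: (kmax (Ordinal nN)).
  by apply/ltW/(lt_le_trans (dN _ nN)); exact: (kmax (Ordinal k0N)).
have dk_gt : 0 < d k by apply: lt_le_trans (dk k0).
case: k kN kmax dk dk_gt => [|k] kN kmax dk; first by rewrite dz ltxx.
move=> dk_gt; have : ((d k.+1)%:E < (d k.+1)%:E)%E; last by rewrite ltxx.
have wa_ge0 u : 0 <= wa u by rewrite ltW.
rewrite {1}dE; apply: (@average_lt _ _ _ _ 0%N) => //.
- by move=> v; apply: nneseries_ge0 => u _ _; rewrite mule_ge0 ?lee_fin.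
- by move=> v; apply: average_le => // u; rewrite lee_fin.
(* The strict term is no service together with an arrival of size [k.+1]: the index drops to 0,
   where [d] vanishes, and both weights are positive. *)
- apply: (@average_lt _ _ _ _ k.+1) => // [u|u|]; rewrite ?lee_fin //.
  by rewrite addn0 subnn dz lte_fin.
Qed.

(** * The queue with natural-valued inputs *)

Lemma eq_measure_ae (d : measure_display) (T : measurableType d)
    (R : realType) (mu : {measure set T -> \bar R}) (A B : set T) :
  measurable A -> measurable B -> {ae mu, forall w, A w <-> B w} ->
  mu A = mu B.
Proof.
move=> mA mB [N [mN N0 AB]].
have le C D : measurable C -> measurable D -> C `<=` D `|` N -> (mu C <= mu D)%E.
  move=> mC mD CD; rewrite -(measureU0 mD mN N0).
  by apply: le_measure; rewrite ?inE //; exact: measurableU.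
apply/eqP; rewrite eq_le !le // => w hw; have [Nw|Nw] := pselect (N w);
  by [right|left; apply: contrapT => nw; apply/Nw/AB => -[/= h1 h2]; auto].
Qed.

Lemma ae_forall_int (d : measure_display) (T : measurableType d)
    (R : realType) (mu : {measure set T -> \bar R}) (Q : int -> T -> Prop) :
  (forall n, {ae mu, forall w, Q n w}) -> {ae mu, forall w n, Q n w}.
Proof.
move=> hQ.
have h1 := @ae_foralln _ _ _ mu (fun n => Q n%:Z) (fun n => hQ n%:Z).
have h2 := @ae_foralln _ _ _ mu (fun n => Q (Negz n)) (fun n => hQ (Negz n)).
by apply: filterS2 h1 h2 => w q1 q2 [].
Qed.

Lemma measurable_nat_preimage (d : measure_display) (T : measurableType d)
    (V : T -> nat) (B : set nat) :
  measurable_fun setT V -> measurable (V @^-1` B).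
Proof. by move=> mV; rewrite -[X in measurable X]setTI; exact: mV. Qed.

Section Mass.
Context {R : realType}.
Implicit Types (w : nat -> R) (B : set nat).

Definition mass w B : \bar R := \sum_(0 <= k <oo) (if `[< B k >] then w k else 0)%:E.

Lemma mass_ge0 w B : (forall k, 0 <= w k) -> (0 <= mass w B)%E.
Proof.
by move=> w0; apply: nneseries_ge0 => k _ _; rewrite lee_fin; case: ifP.
Qed.

Lemma mass_fin w B : (forall k, 0 <= w k) ->
  (\sum_(0 <= k <oo) (w k)%:E = 1)%E -> mass w B \is a fin_num.
Proof.
move=> w0 w1; rewrite ge0_fin_numE ?mass_ge0 //.
apply: (@le_lt_trans _ _ 1%E); last exact: ltry.
rewrite -w1; apply: lee_nneseries => k _; rewrite lee_fin; by case: ifP.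
Qed.

Lemma mass1 w k : (forall k, 0 <= w k) -> mass w [set k] = (w k)%:E.
Proof.
move=> w0; rewrite /mass (@nneseriesD1 _ _ k) //; last first.
  by move=> i _; rewrite lee_fin; case: ifP.
rewrite asboolT // eseries0 ?adde0 // => i _ /andP[_ /eqP ik].
by rewrite asboolF.
Qed.

Lemma mass0 w B : (forall k, ~ B k) -> mass w B = 0%E.
Proof. by move=> B0; apply: eseries0 => i _ _; rewrite asboolF. Qed.

Lemma massE (d : measure_display) (T : measurableType d)
    (P : probability T R) (w : nat -> R) (V : T -> nat) B :
  measurable_fun setT V -> (forall k, P (V @^-1` [set k]) = (w k)%:E) ->
  P (V @^-1` B) = mass w B.
Proof.
move=> mV Vw; rewrite (total_probability P mV (measurable_nat_preimage B mV)).
apply: eq_eseriesr => k _; case: asboolP => Bk.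
  by rewrite -Vw; congr (P _); apply/seteqP; split => [t []//|t /= ->].
rewrite (_ : _ `&` _ = set0) ?measure0 //; apply/seteqP; split=> // t [Bt Vt].
  by apply: Bk; rewrite -Vt.
Qed.

End Mass.

Definition scons (B : set nat) (U : nat -> set nat) (i : nat) : set nat :=
  if i is j.+1 then U j else B.

Section NatQueue.
Context {d : measure_display} {T : measurableType d} {R : realType}.
Context (P : probability T R) (a s : int -> T -> nat) (wa wb H : nat -> R).
Context (ma : forall n, measurable_fun setT (a n))
  (ms : forall n, measurable_fun setT (s n)).

(** Prescribes the inputs at the times [n], ..., [n + k - 1]: the future seen from the queue at time
    [n]. *)
Definition input_event (n : int) (k : nat) (U V : nat -> set nat) : set T :=
  [set w | forall i, (i < k)%N ->
     U i (a (n + i%:Z) w) /\ V i (s (n + i%:Z) w)].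

Context (wa_gt0 : forall k, 0 < wa k) (wb_ge0 : forall k, 0 <= wb k)
  (wb0 : 0 < wb 0%N)
  (wa_sum : (\sum_(0 <= k <oo) (wa k)%:E = 1)%E)
  (wb_sum : (\sum_(0 <= k <oo) (wb k)%:E = 1)%E)
  (input_law : forall n k U V, P (input_event n k U V) =
     (\prod_(i < k) (mass wa (U i) * mass wb (V i)))%E).

Lemma measurable_input_event n k U V : measurable (input_event n k U V).
Proof.
rewrite (_ : input_event n k U V = \bigcap_(i in `I_k)
    (a (n + i%:Z) @^-1` U i `&` s (n + i%:Z) @^-1` V i)); last first.
  by apply/seteqP; split => w h i /h.
apply: fin_bigcap_measurable => [|i _]; first exact: finite_II.
by apply: measurableI; exact: measurable_nat_preimage.
Qed.

Let wa_ge0 k : 0 <= wa k. Proof. exact: ltW. Qed.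

Lemma input_event_scons n k u v U V :
  P (input_event n k.+1 (scons [set u] U) (scons [set v] V)) =
  ((wb v)%:E * ((wa u)%:E * P (input_event (n + 1) k U V)))%E.
Proof.
rewrite !input_law big_ord_recl /= !mass1 // muleA; congr (_ * _)%E.
by rewrite muleC.
Qed.

Lemma input_event_sconsE n k A B U V w :
  input_event n k.+1 (scons A U) (scons B V) w <->
  [/\ A (a n w), B (s n w) & input_event (n + 1) k U V w].
Proof.
split => [h|[hA hB h] [|i] ik]; last first.
- by have := h i ik; rewrite -addrA -PoszD add1n.
- by rewrite addr0.
split; [by have [] := h 0%N isT; rewrite addr0|
        by have [] := h 0%N isT; rewrite addr0|].
by move=> i ik; have := h i.+1 ik; rewrite -addrA -PoszD add1n.
Qed.

Lemma total_input n E : measurable E ->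
  P E = (\sum_(0 <= v <oo) \sum_(0 <= u <oo)
          P (E `&` [set w | a n w = u /\ s n w = v]))%E.
Proof.
move=> mE; rewrite (total_probability P (ms n) mE); apply: eq_eseriesr => v _.
have mEv : measurable (E `&` s n @^-1` [set v]).
  by apply: measurableI => //; exact: measurable_nat_preimage.
rewrite (total_probability P (ma n) mEv); apply: eq_eseriesr => u _; congr (P _).
by apply/seteqP; split => w /=; tauto.
Qed.

(* The queue at time [n] when it is empty at time [n - N]. *)
Fixpoint queue_from_empty (N : nat) (n : int) (w : T) : nat :=
  if N is M.+1 then
    (queue_from_empty M (n - 1) w + a (n - 1) w - s (n - 1) w)%N
  else 0%N.

Local Notation qn := queue_from_empty.

Lemma queue_from_emptyS N n w :
  qn N.+1 (n + 1) w = (qn N n w + a n w - s n w)%N.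
Proof. by rewrite /= addrK. Qed.

Lemma measurable_queue_from_empty N n : measurable_fun setT (qn N n).
Proof.
elim: N n => [|N IH] n; first exact: measurable_cst.
apply: measurable_fun_subn => //; exact: measurable_fun_addn.
Qed.

Lemma queue_from_empty_mono n w : {homo (fun N => qn N n w) : M N / (M <= N)%N}.
Proof.
apply: homo_leq => [//|? ? ?|N]; first exact: leq_trans.
elim: N n => [//|N IH] n; rewrite /= leq_sub2r // leq_add2r; exact: IH.
Qed.

(** Computed from the weights alone, hence independent of the time. The recursion peels off the last
    step by replacing [B] with its preimage under that step. *)
Fixpoint law_from_empty (N : nat) (B : set nat) : \bar R :=
  if N is M.+1 then
    (\sum_(0 <= v <oo) (wb v)%:E * \sum_(0 <= u <oo) (wa u)%:E *
       law_from_empty M [set x | B (x + u - v)%N])%E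
  else if `[< B 0%N >] then 1%E else 0%E.

Lemma law_from_empty_ge0 N B : (0 <= law_from_empty N B)%E.
Proof.
elim: N B => [|N IH] B /=; first by case: ifP.
apply: nneseries_ge0 => v _ _; rewrite mule_ge0 ?lee_fin //.
by apply: nneseries_ge0 => u _ _; rewrite mule_ge0 ?lee_fin.
Qed.

(** The future event must be arbitrary for the induction: the inputs at time [n - 1] that produce
    the queue at [n] become part of the future of the queue at [n - 1]. *)
Lemma queue_from_empty_law N n B k U V :
  P (qn N n @^-1` B `&` input_event n k U V) =
  (law_from_empty N B * P (input_event n k U V))%E.
Proof.
elim: N n B k U V => [|N IH] n B k U V.
  rewrite /=; case: asboolP => B0.
    by rewrite mul1e; congr (P _); apply/seteqP; split => [w []//|w].
  by rewrite mul0e (_ : _ `&` _ = set0) ?measure0 //; apply/seteqP; split => w [].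
have mI := measurable_input_event n k U V.
have -> : P (input_event n k U V) = (fine (P (input_event n k U V)))%:E.
  by rewrite fineK // fin_num_measure.
rewrite (total_input (n - 1)); last first.
  apply: measurableI => //; apply: measurable_nat_preimage.
  exact: measurable_queue_from_empty.
rewrite [law_from_empty _ _]/= muleC -nneseriesZl; last first.
  move=> v _; rewrite mule_ge0 ?lee_fin //.
  apply: nneseries_ge0 => u _ _; rewrite mule_ge0 ?lee_fin //.
  exact: law_from_empty_ge0.
apply: eq_eseriesr => v _; rewrite muleCA -nneseriesZl; last first.
  move=> u _; rewrite mule_ge0 ?lee_fin //; exact: law_from_empty_ge0.
rewrite -nneseriesZl; last first.
  move=> u _; rewrite mule_ge0 ?lee_fin ?fine_ge0 // mule_ge0 ?lee_fin //.
  exact: law_from_empty_ge0.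
apply: eq_eseriesr => u _.
have -> : qn N.+1 n @^-1` B `&` input_event n k U V `&`
    [set w | a (n - 1) w = u /\ s (n - 1) w = v] =
  qn N (n - 1) @^-1` [set x | B (x + u - v)%N] `&`
    input_event (n - 1) k.+1 (scons [set u] U) (scons [set v] V).
  apply/seteqP; split => w; rewrite /setI /preimage /=.
    move=> [[hB hI] [<- <-]]; split => //.
    by apply/input_event_sconsE; rewrite subrK.
  by move=> [hB /input_event_sconsE[/= -> ->]]; rewrite subrK.
rewrite IH input_event_scons subrK -[in LHS](@fineK _ (P _)) ?fin_num_measure //.
by rewrite muleC -!muleA (muleCA (fine _)%:E).
Qed.

(** Since the queues started empty increase with [N], this says that their limit is at least [k],
    and it makes sense where the limit is infinite. *)
Definition queue_ge (n : int) (k : nat) : set T :=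
  [set w | exists N, (k <= qn N n w)%N].

Lemma queue_geE n k :
  queue_ge n k = \bigcup_N (qn N n @^-1` [set x | (k <= x)%N]).
Proof. by apply/seteqP; split => [w [N ?]|w [N _ ?]]; exists N. Qed.

Lemma measurable_queue_ge n k : measurable (queue_ge n k).
Proof.
rewrite queue_geE; apply: bigcupT_measurable => N.
by apply: measurable_nat_preimage; exact: measurable_queue_from_empty.
Qed.

Lemma queue_ge0 n w : queue_ge n 0 w. Proof. by exists 0%N. Qed.

Lemma queue_ge_le n k j w : (j <= k)%N -> queue_ge n k w -> queue_ge n j w.
Proof. by move=> jk [N kN]; exists N; exact: leq_trans kN. Qed.

(** A positive threshold is insensitive to the truncation at 0, so the recursion inverts; a
    threshold truncated to 0 on the right is reached by every queue. *)
Lemma queue_geS n k w :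
  queue_ge (n + 1) k.+1 w <-> queue_ge n (k.+1 + s n w - a n w)%N w.
Proof.
split => [[[//|N]]|[N hN]].
  by rewrite queue_from_emptyS => hN; exists N; lia.
by exists N.+1; rewrite queue_from_emptyS; lia.
Qed.

(** * Tail of the stationary queue length *)

Definition tail_law (k : nat) : \bar R :=
  limn (fun N => law_from_empty N [set x | (k <= x)%N]).

Let cvg_queue_ge n k j U V :
  (fun N => law_from_empty N [set x | (k <= x)%N] * P (input_event n j U V))%E
    @ \oo --> P (queue_ge n k `&` input_event n j U V).
Proof.
pose F N := qn N n @^-1` [set x | (k <= x)%N] `&` input_event n j U V.
have mF N : measurable (F N).
  apply: measurableI; last exact: measurable_input_event.
  by apply: measurable_nat_preimage; exact: measurable_queue_from_empty.
rewrite (_ : _ `&` _ = \bigcup_N F N); last by rewrite queue_geE setI_bigcupl.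
rewrite (_ : (fun N => _) = P \o F); last first.
  by apply/funext => N /=; rewrite -queue_from_empty_law.
apply: nondecreasing_cvg_mu => //; first exact: bigcupT_measurable.
move=> M N MN; apply/subsetPset => w [/= kM hI]; split => //=.
by apply: leq_trans kM _; exact: queue_from_empty_mono.
Qed.

Let input_event0 n U V : input_event n 0 U V = setT.
Proof. by apply/seteqP; split => w. Qed.

Lemma queue_ge_law n k : P (queue_ge n k) = tail_law k.
Proof.
have := @cvg_queue_ge n k 0 (fun=> setT) (fun=> setT).
rewrite input_event0 setIT probability_setT => /cvg_lim <- //.
by congr (limn _); apply/funext => N; rewrite mule1.
Qed.

Lemma queue_ge_indep n k j U V :
  P (queue_ge n k `&` input_event n j U V) =
  (tail_law k * P (input_event n j U V))%E.
Proof.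
have := @cvg_queue_ge n k 0 (fun=> setT) (fun=> setT).
rewrite input_event0 setIT probability_setT queue_ge_law.
under eq_fun do rewrite mule1.
have Pfin : P (input_event n j U V) \is a fin_num.
  by apply: fin_num_measure; exact: measurable_input_event.
move=> /(cvgeZr Pfin) h.
have := @cvg_queue_ge n k j U V; move: h.
by move=> /cvg_lim <- // /cvg_lim <-.
Qed.

Lemma tail_law_ge0 k : (0 <= tail_law k)%E.
Proof. by rewrite -(queue_ge_law 0 k). Qed.

Lemma tail_law0 : tail_law 0 = 1%E.
Proof.
rewrite -(queue_ge_law 0) -[RHS](probability_setT P); congr (P _).
by apply/seteqP; split => // w _; exact: queue_ge0.
Qed.

Lemma tail_lawS k : tail_law k.+1 =
  (\sum_(0 <= v <oo) (wb v)%:E *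
     \sum_(0 <= u <oo) (wa u)%:E * tail_law (k.+1 + v - u)%N)%E.
Proof.
rewrite -(queue_ge_law (0 + 1)) (total_input 0); last exact: measurable_queue_ge.
apply: eq_eseriesr => v _.
rewrite -nneseriesZl; last first.
  by move=> u _; rewrite mule_ge0 ?lee_fin //; exact: tail_law_ge0.
apply: eq_eseriesr => u _.
rewrite (_ : _ `&` _ = queue_ge 0 (k.+1 + v - u) `&`
  input_event 0 1 (scons [set u] (fun=> setT)) (scons [set v] (fun=> setT))).
  rewrite queue_ge_indep input_event_scons input_event0 probability_setT mule1.
  by rewrite muleC muleA.
apply/seteqP; split => w.
  move=> [/queue_geS h [/= au sv]]; rewrite -au -sv; split => //.
  exact/input_event_sconsE.
move=> [h /input_event_sconsE [/= au sv _]]; split => //.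
by apply/queue_geS; rewrite au sv.
Qed.

Context (H0 : H 0%N = 1) (H_ge0 : forall k, 0 <= H k) (H_cvg : H @ \oo --> 0)
  (HS : forall k, ((H k.+1)%:E = \sum_(0 <= v <oo) (wb v)%:E *
     \sum_(0 <= u <oo) (wa u)%:E * (H (k.+1 + v - u)%N)%:E)%E).

Lemma law_from_empty_le1 N B : (law_from_empty N B <= 1)%E.
Proof.
have := queue_from_empty_law N 0 B 0 (fun=> setT) (fun=> setT).
rewrite input_event0 setIT probability_setT mule1 => <-.
apply: probability_le1; apply: measurable_nat_preimage.
exact: measurable_queue_from_empty.
Qed.

(** By [H0] and [H_ge0] the tail of the empty queue lies below [H], and by [HS] the function [H] is
    fixed by the one-step operator, whose weights are nonnegative. *)
Lemma law_from_empty_le N k : (law_from_empty N [set x | (k <= x)%N] <= (H k)%:E)%E.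
Proof.
elim: N k => [|N IH] [|k]; rewrite ?H0 ?law_from_empty_le1 //=.
  by rewrite asboolF // lee_fin.
have ge0 v u : (0 <= (wa u)%:E * law_from_empty N [set x | (k < x + u - v)%N])%E.
  by rewrite mule_ge0 ?lee_fin //; exact: law_from_empty_ge0.
rewrite HS; apply: lee_nneseries => [v _ _|v _].
  by rewrite mule_ge0 ?lee_fin //; apply: nneseries_ge0 => u _ _; exact: ge0.
rewrite lee_wpmul2l ?lee_fin //; apply: lee_nneseries => [u _ _|u _]; first exact: ge0.
rewrite lee_wpmul2l ?lee_fin //; apply: le_trans (IH _).
rewrite le_eqVlt; apply/orP; left; apply/eqP; congr (law_from_empty _ _).
by apply/seteqP; split => x /=; lia.
Qed.

Lemma tail_lawE k : tail_law k = (H k)%:E.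
Proof.
have L_fin j : tail_law j = (fine (tail_law j))%:E.
  rewrite fineK // -(queue_ge_law 0) fin_num_measure //; exact: measurable_queue_ge.
have LH j : (tail_law j <= (H j)%:E)%E.
  apply: lime_le; last by apply: nearW => N; exact: law_from_empty_le.
  have := @cvg_queue_ge 0 j 0 (fun=> setT) (fun=> setT).
  rewrite input_event0 setIT probability_setT.
  by under eq_fun do rewrite mule1; move=> /cvgP.
pose dd j := H j - fine (tail_law j).
suff /(_ k) : forall j, dd j = 0.
  by move/subr0_eq ->; rewrite -L_fin.
have dd0 j : 0 <= dd j by rewrite subr_ge0 -lee_fin -L_fin.
apply: (harmonic_eq0 wa_gt0 wa_sum wb_ge0 wb_sum wb0) => //.
- by rewrite /dd tail_law0 H0 subrr.
- apply: (@squeeze_cvgr _ _ _ _ (fun=> 0) H) => //; last exact: cvg_cst.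
  by apply: nearW => j; rewrite dd0 gerBl fine_ge0 // tail_law_ge0.
move=> j.
have ge0L v u : (0 <= (wa u)%:E * tail_law (j.+1 + v - u)%N)%E.
  by rewrite mule_ge0 ?lee_fin // tail_law_ge0.
have ge0d v u : (0 <= (wa u)%:E * (dd (j.+1 + v - u)%N)%:E)%E.
  by rewrite mule_ge0 ?lee_fin.
have sumL v : (0 <= \sum_(0 <= u <oo) (wa u)%:E * tail_law (j.+1 + v - u)%N)%E.
  by apply: nneseries_ge0 => u _ _; exact: ge0L.
have sumd v : (0 <= \sum_(0 <= u <oo) (wa u)%:E * (dd (j.+1 + v - u)%N)%:E)%E.
  by apply: nneseries_ge0 => u _ _; exact: ge0d.
(* Writing [H] as [tail_law] plus a second series of nonnegative terms avoids subtracting infinite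
   series in the extended reals. *)
have splitH : ((H j.+1)%:E = tail_law j.+1 + \sum_(0 <= v <oo) (wb v)%:E *
     \sum_(0 <= u <oo) (wa u)%:E * (dd (j.+1 + v - u)%N)%:E)%E.
  rewrite HS tail_lawS -nneseriesD; try by move=> v _ _; rewrite mule_ge0 ?lee_fin.
  apply: eq_eseriesr => v _; rewrite -muleDr //; last by rewrite ge0_adde_def ?inE.
  congr (_ * _)%E; rewrite -nneseriesD //.
  apply: eq_eseriesr => u _; rewrite -muleDr //; last first.
    by rewrite ge0_adde_def ?inE ?tail_law_ge0 ?lee_fin.
  by rewrite L_fin -EFinD addrC subrK.
by rewrite EFinB -L_fin splitH L_fin addeAC subee // add0e.
Qed.

Definition queue_finite (w : T) : Prop := forall n, exists k, ~ queue_ge n k w.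

(** Continuity from above: the queue at time [n] is infinite on the intersection of the events
    [queue_ge n k], whose probabilities [H k] tend to 0. *)
Lemma queue_finite_ae : {ae P, forall w, queue_finite w}.
Proof.
apply: ae_forall_int => n.
have mge k : measurable (queue_ge n k) by exact: measurable_queue_ge.
exists (\bigcap_k queue_ge n k); split; first exact: bigcapT_measurable.
  have : P \o queue_ge n @ \oo --> P (\bigcap_k queue_ge n k).
    apply: nonincreasing_cvg_mu => //; first by rewrite ltey_eq fin_num_measure.
      exact: bigcapT_measurable.
    by move=> i j ij; apply/subsetPset => w; exact: queue_ge_le.
  rewrite (_ : P \o _ = EFin \o H); last first.
    by apply/funext => k /=; rewrite queue_ge_law tail_lawE.
  have : (EFin \o H) @ \oo --> 0%:E by apply: cvg_EFin H_cvg; exact: nearW.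
  by move=> h1 h2; exact: (cvg_unique (@ereal_hausdorff R) h2 h1).
move=> w /= nfin k _; apply: contrapT => nk; apply: nfin; by exists k.
Qed.

(* The value is 0 where the queue is infinite. *)
Definition nat_queue (n : int) (w : T) : nat :=
  xget 0%N [set k | queue_ge n k w /\ ~ queue_ge n k.+1 w].

Lemma nat_queueP n w : (exists k, ~ queue_ge n k w) ->
  forall k, queue_ge n k w <-> (k <= nat_queue n w)%N.
Proof.
move=> fin.
have [k hk] : exists k, queue_ge n k w /\ ~ queue_ge n k.+1 w.
  have ex : exists k, `[< ~ queue_ge n k w >].
    by case: fin => k nk; exists k; exact/asboolP.
  case: (ex_minnP ex) => -[|k] /asboolP nk kmin.
    by case: nk; exact: queue_ge0.
  exists k; split => //; apply: contrapT => nk'.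
  by have := kmin k (introT (asboolP _) nk'); rewrite ltnn.
have [q1 q2] : queue_ge n (nat_queue n w) w /\ ~ queue_ge n (nat_queue n w).+1 w.
  by rewrite /nat_queue; case: xgetP => [//|/(_ k)].
move=> j; split => [gj|/queue_ge_le]; last exact.
by rewrite leqNgt; apply/negP => /queue_ge_le /(_ gj).
Qed.

Lemma nat_queueS n w : queue_finite w ->
  nat_queue (n + 1) w = (nat_queue n w + a n w - s n w)%N.
Proof.
move=> fin.
have eq k : (k < nat_queue (n + 1) w)%N <->
            (k.+1 + s n w - a n w <= nat_queue n w)%N.
  by rewrite -(nat_queueP (fin n)) -queue_geS; apply: iff_sym; exact: nat_queueP.
(* The predecessors of the two sides are the thresholds that yield the two inequalities. *)
move: (eq (nat_queue (n + 1) w).-1) (eq (nat_queue n w + a n w - s n w).-1).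
by clear; lia.
Qed.

Lemma measurable_nat_queue n : measurable_fun setT (nat_queue n).
Proof.
move=> _ Y _; rewrite setTI.
have mge k : measurable (queue_ge n k) by exact: measurable_queue_ge.
have mcap : measurable (\bigcap_k queue_ge n k) by exact: bigcapT_measurable.
have mk k : measurable (nat_queue n @^-1` [set k]).
  (* The level set of 0 also contains the paths with infinite queue, which receive the default
     value. *)
  have -> : nat_queue n @^-1` [set k] =
      (queue_ge n k `\` queue_ge n k.+1) `|`
      (if k is 0%N then \bigcap_j queue_ge n j else set0).
    have inf w : (forall j, queue_ge n j w) -> nat_queue n w = 0%N.
      by move=> h; rewrite /nat_queue xgetPN // => j [_]; apply; exact: h.
    apply/seteqP; split => w.
      move=> <-; have [fin|nfin] := pselect (exists j, ~ queue_ge n j w).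
        left; split; first exact/(nat_queueP fin).
        by move/(nat_queueP fin); rewrite ltnn.
      have h j : queue_ge n j w by apply: contrapT => nj; apply: nfin; exists j.
      by right; rewrite inf.
    case=> [[h1 h2]|]; last by case: k => // h; apply: inf => j; exact: h.
    have fin : exists j, ~ queue_ge n j w by exists k.+1.
    apply/eqP; rewrite eqn_leq; apply/andP; split.
      by rewrite leqNgt; apply/negP => /(nat_queueP fin).
    exact/(nat_queueP fin).
  by apply: measurableU; [exact: measurableD|case: k].
rewrite (_ : _ @^-1` _ = \bigcup_(k in Y) (nat_queue n @^-1` [set k])).
  exact: bigcup_measurable.
apply/seteqP; split => [w hY|w [k Yk hk]]; first by exists (nat_queue n w).
by rewrite /preimage /= hk.
Qed.

Definition qmass (k : nat) : R := H k - H k.+1.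

(** This replaces the Markov property: path laws are computed from the queue at one time and the
    inputs from then on. It is the difference of two instances of [queue_ge_indep]. *)
Lemma nat_queue_input n k j U V :
  P (nat_queue n @^-1` [set k] `&` input_event n j U V) =
  ((qmass k)%:E * P (input_event n j U V))%E.
Proof.
have mI := measurable_input_event n j U V.
have mge i : measurable (queue_ge n i `&` input_event n j U V).
  by apply: measurableI => //; exact: measurable_queue_ge.
transitivity (P ((queue_ge n k `&` input_event n j U V) `\`
                 (queue_ge n k.+1 `&` input_event n j U V))).
  apply: eq_measure_ae; last 1 first.
  - apply: filterS queue_finite_ae => w fin; rewrite /setI /setD /preimage /=.
    rewrite !(nat_queueP (fin n)); split.
      by move=> [-> hI]; rewrite leqnn ltnn; split => // -[].
    move=> [[h1 hI] h2]; split => //; apply/eqP; rewrite eqn_leq h1 andbT.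
    by rewrite leqNgt; apply/negP => h; apply: h2.
  - apply: measurableI => //; apply: measurable_nat_preimage.
    exact: measurable_nat_queue.
  - exact: measurableD.
have Pfin i : P (queue_ge n i `&` input_event n j U V) \is a fin_num.
  by rewrite fin_num_measure.
rewrite measureD //; last by rewrite ltey_eq Pfin.
rewrite (@setIidr _ (_ `&` _) (_ `&` _)); last first.
  by move=> w [h hI]; split => //; exact: (queue_ge_le (leqnSn k)).
transitivity ((H k)%:E * P (input_event n j U V) -
              (H k.+1)%:E * P (input_event n j U V))%E.
  by rewrite -!tail_lawE; congr (_ - _)%E; exact: queue_ge_indep.
rewrite -(@fineK _ (P (input_event n j U V))) ?fin_num_measure //.
by rewrite -!EFinM -EFinB mulrBl.
Qed.

Lemma nat_queue_law n k : P (nat_queue n @^-1` [set k]) = (qmass k)%:E.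
Proof.
have := nat_queue_input n k 0 (fun=> setT) (fun=> setT).
by rewrite input_event0 probability_setT mule1 setIT.
Qed.

Lemma qmass_ge0 k : 0 <= qmass k.
Proof. by rewrite -lee_fin -(nat_queue_law 0) measure_ge0. Qed.

Lemma qmass_sum : (\sum_(0 <= k <oo) (qmass k)%:E = 1)%E.
Proof.
rewrite -(probability_setT P) (total_probability P (measurable_nat_queue 0)) //.
by apply: eq_eseriesr => k _; rewrite setTI; exact/esym/nat_queue_law.
Qed.

Lemma massT (w : nat -> R) : mass w setT = (\sum_(0 <= k <oo) (w k)%:E)%E.
Proof. by apply: eq_eseriesr => k _; rewrite asboolT. Qed.

Lemma input_scons n k A B U V :
  P (input_event n k.+1 (scons A U) (scons B V)) =
  (mass wa A * mass wb B * P (input_event (n + 1) k U V))%E.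
Proof. by rewrite !input_law big_ord_recl. Qed.

(** * Half-step kernels and laws of finite paths *)

Definition karr (x y : nat) : \bar R := mass wa [set u | (x + u = y)%N].
Definition ksrv (y x : nat) : \bar R := mass wb [set v | (y - v = x)%N].

Lemma karr_ge0 x y : (0 <= karr x y)%E. Proof. exact: mass_ge0. Qed.
Lemma ksrv_ge0 y x : (0 <= ksrv y x)%E. Proof. exact: mass_ge0. Qed.

Lemma karr_fin x y : karr x y \is a fin_num.
Proof. exact: mass_fin. Qed.

Lemma ksrv_fin y x : ksrv y x \is a fin_num.
Proof. exact: mass_fin. Qed.

Lemma karrD x u : karr x (x + u) = (wa u)%:E.
Proof.
rewrite -mass1 //; congr (mass _ _).
by apply/seteqP; split => v /=; lia.
Qed.

Lemma service_law n k : P (s n @^-1` [set k]) = (wb k)%:E.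
Proof.
have := input_scons n 0 setT [set k] (fun=> setT) (fun=> setT).
rewrite mass1 // massT wa_sum mul1e input_event0 probability_setT mule1 => <-.
congr (P _); apply/seteqP; split => w.
  by move=> /= h; apply/input_event_sconsE.
by move=> /input_event_sconsE[].
Qed.

Lemma ksrv_sum y : (\sum_(0 <= x <oo) ksrv y x = 1)%E.
Proof.
have m : measurable_fun setT (fun w => (y - s 0 w)%N) by apply: measurable_fun_subn.
rewrite -(probability_setT P) (total_probability P m) //.
apply: eq_eseriesr => x _; rewrite setTI.
apply: esym; apply: (@massE _ _ _ P wb (s 0) [set v | (y - v)%N = x]) => // k.
exact: service_law.
Qed.

Context (wy : nat -> R)
  (balance : forall x y, ((qmass x)%:E * karr x y = (wy y)%:E * ksrv y x)%E).

(** Detailed balance is summed over [x], and the service kernel has total mass 1. Thus [wy], known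
    so far only through [balance], is the law after an arrival. *)
Lemma qmass_karr_sum y : (\sum_(0 <= x <oo) (qmass x)%:E * karr x y = (wy y)%:E)%E.
Proof.
under eq_eseriesr do rewrite balance.
by rewrite nneseriesZl ?ksrv_sum ?mule1 // => x _; exact: ksrv_ge0.
Qed.

Definition nat_after_arrival (n : int) (w : T) : nat := (nat_queue n w + a n w)%N.
Definition nat_departures (n : int) (w : T) : nat :=
  minn (nat_after_arrival n w) (s n w).

Local Notation xq := nat_queue.
Local Notation yq := nat_after_arrival.
Local Notation dq := nat_departures.

Lemma measurable_nat_after_arrival n : measurable_fun setT (yq n).
Proof. by apply: measurable_fun_addn => //; exact: measurable_nat_queue. Qed.

Lemma measurable_nat_departures n : measurable_fun setT (dq n).
Proof.
rewrite (_ : dq n = fun w => (yq n w - (yq n w - s n w))%N).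
  have my := measurable_nat_after_arrival n.
  by apply: measurable_fun_subn => //; exact: measurable_fun_subn.
by apply/funext => w; rewrite /dq; lia.
Qed.

Definition forward_path (m : int) (k : nat) (v : nat -> nat * nat) : set T :=
  [set w | forall i, (i <= k)%N ->
     xq (m + i%:Z) w = (v i).1 /\ yq (m + i%:Z) w = (v i).2].

(** Here [X] is one time ahead of [Y]: in half steps the path starts at Y_m and ends at X_{m+k+1},
    which is the shape of a forward path read in reverse. *)
Definition backward_path (m : int) (k : nat) (v : nat -> nat * nat) : set T :=
  [set w | forall i, (i <= k)%N ->
     xq (m + i%:Z + 1) w = (v i).1 /\ yq (m + i%:Z) w = (v i).2].

Lemma measurable_forward_path m k v : measurable (forward_path m k v).
Proof.
rewrite (_ : forward_path m k v = \bigcap_(i in `I_k.+1)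
  (xq (m + i%:Z) @^-1` [set (v i).1] `&` yq (m + i%:Z) @^-1` [set (v i).2])).
  apply: fin_bigcap_measurable => [|i _]; first exact: finite_II.
  apply: measurableI; apply: measurable_nat_preimage.
    exact: measurable_nat_queue.
  exact: measurable_nat_after_arrival.
by apply/seteqP; split => w h i /h.
Qed.

Lemma measurable_backward_path m k v : measurable (backward_path m k v).
Proof.
rewrite (_ : backward_path m k v = \bigcap_(i in `I_k.+1)
  (xq (m + i%:Z + 1) @^-1` [set (v i).1] `&` yq (m + i%:Z) @^-1` [set (v i).2])).
  apply: fin_bigcap_measurable => [|i _]; first exact: finite_II.
  apply: measurableI; apply: measurable_nat_preimage.
    exact: measurable_nat_queue.
  exact: measurable_nat_after_arrival.
by apply/seteqP; split => w h i /h.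
Qed.

Lemma measurable_nat_queue_input n x k U V :
  measurable (xq n @^-1` [set x] `&` input_event n k U V).
Proof.
apply: measurableI; last exact: measurable_input_event.
by apply: measurable_nat_preimage; exact: measurable_nat_queue.
Qed.

Lemma addzS (m : int) i : m + i.+1%:Z = m + i%:Z + 1.
Proof. by rewrite -addrA -PoszD addn1. Qed.

Lemma forward_path_law m k v :
  P (forward_path m k v) =
  ((qmass (v 0%N).1)%:E *
   (\prod_(i < k) (karr (v i).1 (v i).2 * ksrv (v i).2 (v i.+1).1)) *
   karr (v k).1 (v k).2)%E.
Proof.
pose U i := [set u | ((v i).1 + u)%N = (v i).2].
(* The path stops after its last arrival, so the last service is unconstrained. *)
pose V i := if (i < k)%N then [set u | ((v i).2 - u)%N = (v i.+1).1] else setT.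
transitivity (P (xq m @^-1` [set (v 0%N).1] `&` input_event m k.+1 U V)).
  apply: eq_measure_ae; [exact: measurable_forward_path|
    exact: measurable_nat_queue_input|].
  apply: filterS queue_finite_ae => w fin; split => [h|[/= x0 hI] i].
    split; first by have [] := h 0%N isT; rewrite addr0.
    move=> i ik; have [hx hy] := h i ik; rewrite /U /V /=; split.
      by rewrite -hx -hy.
    case: ltnP => // ik'; have [hx' _] := h i.+1 ik'.
    by rewrite /= -hy -hx' addzS nat_queueS.
  elim: i => [_|i IH ik].
    have [/= h _] := hI 0%N isT; move: h; rewrite /U /= addr0 => h.
    by rewrite x0 /yq; move: x0 h; rewrite /= => -> ->.
  have [hx hy] := IH (ltnW ik).
  have hx' : xq (m + i.+1%:Z) w = (v i.+1).1.
    rewrite addzS nat_queueS //.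
    have [_ ] := hI i (ltnW ik); rewrite /V ik /= => <-.
    by rewrite -hy.
  split => //; rewrite /yq hx'.
  by have [] := hI i.+1 ik.
rewrite nat_queue_input input_law big_ord_recr /= -muleA; congr (_ * _)%E.
rewrite {2}/V ltnn massT wb_sum mule1; congr (_ * _)%E.
by apply: eq_bigr => i _; rewrite /V ltn_ord.
Qed.

Lemma backward_path_law m k v :
  P (backward_path m k v) =
  ((wy (v 0%N).2)%:E * ksrv (v 0%N).2 (v 0%N).1 *
   \prod_(i < k) (karr (v i).1 (v i.+1).2 * ksrv (v i.+1).2 (v i.+1).1))%E.
Proof.
(* [x] is the queue length before the first arrival, which the path does not record and which is
   summed out. *)
pose U x i := [set u | ((if i is j.+1 then (v j).1 else x) + u)%N = (v i).2].
pose V i := [set u | ((v i).2 - u)%N = (v i).1].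
rewrite (total_probability P (measurable_nat_queue m) (measurable_backward_path m k v)).
have split_path x : P (backward_path m k v `&` xq m @^-1` [set x]) =
    P (xq m @^-1` [set x] `&` input_event m k.+1 (U x) V).
  apply: eq_measure_ae; [|exact: measurable_nat_queue_input|].
    apply: measurableI; first exact: measurable_backward_path.
    by apply: measurable_nat_preimage; exact: measurable_nat_queue.
  apply: filterS queue_finite_ae => w fin; split => [[h /= x0]|[/= x0 hI]].
    split => // i ik; have [hx hy] := h i ik; rewrite /U /V /=; split.
      case: i ik hx hy => [|i] ik hx hy; first by rewrite -x0 -hy addr0.
      by have [<- _] := h i (ltnW ik); rewrite -hy addzS.
    by rewrite -hx nat_queueS // -hy.
  split => //; elim => [_|i IH ik].
    have [h1 h2] := hI 0%N isT; move: h1 h2; rewrite /U /V /= addr0 => h1 h2.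
    by rewrite nat_queueS // /yq x0 h1 h2.
  have [hx _] := IH (ltnW ik).
  have [h1 h2] := hI i.+1 ik; move: h1 h2; rewrite /U /V /= => h1 h2.
  by rewrite nat_queueS // /yq addzS hx -addzS h1 h2.
set C := (\prod_(i < k) (karr (v i).1 (v i.+1).2 * ksrv (v i.+1).2 (v i.+1).1))%E.
(* The factor common to all [x] has to be a real number to be moved across the series. *)
have [r rE] : exists r, (ksrv (v 0%N).2 (v 0%N).1 * C = r%:E)%E.
  exists (fine (ksrv (v 0%N).2 (v 0%N).1 * C)); rewrite fineK // fin_numM ?ksrv_fin //.
  rewrite /C; elim/big_ind: _ => [//|? ?|i _]; first exact: fin_numM.
  by rewrite fin_numM ?karr_fin ?ksrv_fin.
rewrite -muleA rE muleC -qmass_karr_sum -nneseriesZl; last first.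
  by move=> x _; rewrite mule_ge0 ?lee_fin ?qmass_ge0 ?karr_ge0.
apply: eq_eseriesr => x _.
rewrite split_path nat_queue_input input_law big_ord_recl -rE /=.
by rewrite [RHS]muleCA (muleC (ksrv _ _ * C)%E) -muleA.
Qed.

(* Detailed balance moves the stationary weight from one end of the path to
   the other. *)
Lemma path_balance k (v : nat -> nat * nat) :
  ((qmass (v 0%N).1)%:E *
     \prod_(i < k) (karr (v i).1 (v i).2 * ksrv (v i).2 (v i.+1).1) =
   \prod_(i < k) (karr (v i.+1).1 (v i).2 * ksrv (v i).2 (v i).1) *
     (qmass (v k).1)%:E)%E.
Proof.
elim: k => [|k IH]; first by rewrite !big_ord0 mul1e mule1.
rewrite !big_ord_recr /= muleA IH -!muleA; congr (_ * _)%E.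
rewrite [LHS]muleA balance [RHS]muleCA (muleC (karr _ _)) balance muleA.
by rewrite (muleC (ksrv _ _)).
Qed.

(** [path_balance] carries the weight to the last queue length, and one more use of [balance]
    crosses the final arrival. The starting times are unrelated because neither path law depends on
    them, so one identity covers reversal about any centre. *)
Lemma path_reversal m m' k (v : nat -> nat * nat) :
  P (forward_path m k v) = P (backward_path m' k (fun i => v (k - i)%N)).
Proof.
rewrite forward_path_law backward_path_law path_balance subn0 -balance.
rewrite -muleA muleC; congr (_ * _)%E.
rewrite (reindex_inj rev_ord_inj) /=; apply: eq_bigr => i _.
by rewrite subnSK.
Qed.

(** * Departures and the current queue length *)

Definition departure_path (m : int) (k : nat) (v : nat -> nat) : set T :=
  [set w | forall i, (i < k)%N -> dq (m + i%:Z) w = v i].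

Lemma measurable_departure_path m k v : measurable (departure_path m k v).
Proof.
rewrite (_ : departure_path m k v = \bigcap_(i in `I_k)
  (dq (m + i%:Z) @^-1` [set v i])); last by apply/seteqP; split => w h i /h.
apply: fin_bigcap_measurable => [|i _]; first exact: finite_II.
by apply: measurable_nat_preimage; exact: measurable_nat_departures.
Qed.

(* Burke's argument: in the induction step, detailed balance and summation over
   the previous queue length turn a departure of size [v k] into an arrival. *)
Lemma departure_queue_input m k v x j U V :
  P (departure_path m k v `&`
     (xq (m + k%:Z) @^-1` [set x] `&` input_event (m + k%:Z) j U V)) =
  ((qmass x)%:E * \prod_(i < k) (wa (v i))%:E * P (input_event (m + k%:Z) j U V))%E.
Proof.
elim: k x j U V => [|k IH] x j U V.
  rewrite big_ord0 mule1 -nat_queue_input; congr (P _).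
  by apply/seteqP; split => [w []|].
(* Departures and remaining queue add up to the queue after arrival, so prescribing both fixes its
   value at time [m + k]. *)
pose y := (x + v k)%N.
set E := (X in P X).
have mE : measurable E.
  apply: measurableI; first exact: measurable_departure_path.
  exact: measurable_nat_queue_input.
rewrite (total_probability P (measurable_nat_queue (m + k%:Z)) mE).
have step x' : P (E `&` xq (m + k%:Z) @^-1` [set x']) =
  P (departure_path m k v `&` (xq (m + k%:Z) @^-1` [set x'] `&`
     input_event (m + k%:Z) j.+1 (scons [set u | (x' + u)%N = y] U)
                                 (scons [set u | (y - u)%N = x] V))).
  apply: eq_measure_ae.
  - apply: measurableI => //; apply: measurable_nat_preimage.
    exact: measurable_nat_queue.
  - apply: measurableI; first exact: measurable_departure_path.
    exact: measurable_nat_queue_input.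
  apply: filterS queue_finite_ae => w fin; rewrite /E addzS; split.
    move=> [[hd [/= hx hI]] /= hx']; split; last split => //.
      by move=> i ik; apply: hd; exact: ltnW.
    apply/input_event_sconsE; have := hd k (ltnSn k); move: hx.
    rewrite nat_queueS // /dq /yq hx' /y /= => hx hdk.
    by split => //; lia.
  move=> [hd [/= hx' /input_event_sconsE [/= ha hs hI]]].
  have hy : yq (m + k%:Z) w = y by rewrite /yq hx'.
  split => //; split; last by split; rewrite //= nat_queueS // -hs -hy.
  move=> i; rewrite ltnS leq_eqVlt => /predU1P[->|/hd//].
  by rewrite /dq hy; move: hs; rewrite /y /=; lia.
set C := (\prod_(i < k) (wa (v i))%:E * P (input_event (m + k.+1%:Z) j U V))%E.
have [r rE] : exists r, (ksrv y x * C = r%:E)%E.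
  exists (fine (ksrv y x * C)); rewrite fineK // !fin_numM ?ksrv_fin //.
    by elim/big_ind: _ => [//|? ?|i _ //]; exact: fin_numM.
  by rewrite fin_num_measure //; exact: measurable_input_event.
transitivity (\sum_(0 <= x' <oo) r%:E * ((qmass x')%:E * karr x' y))%E.
  apply: eq_eseriesr => x' _; rewrite step IH input_scons -rE /C addzS.
  rewrite -/(karr x' y) -/(ksrv y x) [RHS]muleC -!muleA; congr (_ * _)%E.
  by rewrite muleCA; congr (_ * _)%E; rewrite muleCA.
rewrite nneseriesZl; last by move=> x' _; rewrite mule_ge0 ?lee_fin ?qmass_ge0 ?karr_ge0.
rewrite qmass_karr_sum -rE muleC muleA -balance karrD big_ord_recr /= /C.
by rewrite -!muleA; congr (_ * _)%E; rewrite muleCA.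
Qed.

Lemma departure_queue m k v x :
  P (departure_path m k v `&` xq (m + k%:Z) @^-1` [set x]) =
  ((qmass x)%:E * \prod_(i < k) (wa (v i))%:E)%E.
Proof.
have := departure_queue_input m k v x 0 (fun=> setT) (fun=> setT).
by rewrite input_event0 setIT probability_setT mule1.
Qed.

Lemma departure_path_law m k v :
  P (departure_path m k v) = (\prod_(i < k) (wa (v i))%:E)%E.
Proof.
have mD := measurable_departure_path m k v.
rewrite (total_probability P (measurable_nat_queue (m + k%:Z)) mD).
under eq_eseriesr do rewrite departure_queue muleC.
rewrite prodEFin nneseriesZl ?qmass_sum ?mule1 // => x _.
by rewrite lee_fin qmass_ge0.
Qed.

Lemma departure_queue_indep m k v B :
  P (departure_path m k v `&` xq (m + k%:Z) @^-1` B) =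
  (P (departure_path m k v) * P (xq (m + k%:Z) @^-1` B))%E.
Proof.
have mD := measurable_departure_path m k v.
have mx := measurable_nat_queue (m + k%:Z).
have mB := measurable_nat_preimage B mx.
rewrite (total_probability P mx (measurableI _ _ mD mB)).
rewrite (massE B mx (nat_queue_law _)) departure_path_law prodEFin.
rewrite -nneseriesZl; last first.
  by move=> x _; case: asboolP => _; rewrite lee_fin ?qmass_ge0.
apply: eq_eseriesr => x _; case: asboolP => Bx.
  rewrite -prodEFin muleC -(departure_queue m); congr (P _).
  apply/seteqP; split => w [] => [[hd _] hx|hd /= hx]; split => //.
  by rewrite /preimage /= hx.
rewrite mule0 (_ : _ `&` _ = set0) ?measure0 //; apply/seteqP; split => // w [[_ hB] hx].
by apply: Bx; rewrite -hx.
Qed.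

Lemma arrival_path_law m k (v : nat -> nat) :
  P [set w | forall i, (i < k)%N -> a (m + i%:Z) w = v i] =
  (\prod_(i < k) (wa (v i))%:E)%E.
Proof.
transitivity (P (input_event m k (fun i => [set v i]) (fun=> setT))).
  by congr (P _); apply/seteqP; split => w h i /h => [|[]].
by rewrite input_law; apply: eq_bigr => i _; rewrite mass1 // massT wb_sum mule1.
Qed.

Lemma nat_after_arrival_law n y : P (yq n @^-1` [set y]) = (wy y)%:E.
Proof.
have my := measurable_nat_preimage [set y] (measurable_nat_after_arrival n).
rewrite (total_probability P (measurable_nat_queue n) my) -qmass_karr_sum.
apply: eq_eseriesr => x _.
transitivity (P (xq n @^-1` [set x] `&`
    input_event n 1 (scons [set u | (x + u)%N = y] (fun=> setT))
                    (scons setT (fun=> setT)))).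
  congr (P _); apply/seteqP; split => w.
    by move=> [/= hy hx]; split => //; apply/input_event_sconsE; rewrite -hx.
  by move=> [/= hx /input_event_sconsE [/= ha _ _]]; split; rewrite // /yq /= hx.
rewrite nat_queue_input input_scons massT wb_sum input_event0 probability_setT.
by rewrite !mule1.
Qed.

End NatQueue.

(** * Transfer to real-valued processes *)

Lemma measurable_trajectory (d d' : measure_display) (T : measurableType d)
    (E : measurableType d') (I : Type) (Z : I -> T -> E) (C : set (I -> E)) :
  (forall i B, measurable B -> measurable (Z i @^-1` B)) ->
  path_measurable C -> measurable (trajectory Z @^-1` C).
Proof.
move=> mZ mC.
suff : @path_measurable I d' E `<=` [set D | measurable (trajectory Z @^-1` D)].
  by apply.
apply: smallest_sub => [|D [i [B [mB ->]]] /=]; last exact: mZ.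
split=> [|D mD|F mF] /=; first by rewrite preimage_set0.
- by rewrite setTD; exact: measurableC mD.
- by rewrite preimage_bigcup; exact: bigcupT_measurable.
Qed.

Lemma measurable_countable_preimage (d : measure_display) (T : measurableType d)
    (K : countType) (z : T -> K) (B : set K) :
  (forall k, measurable (z @^-1` [set k])) -> measurable (z @^-1` B).
Proof.
move=> mz; pose F m : set T :=
  if (unpickle m : option K) is Some k then
    if `[< B k >] then z @^-1` [set k] else set0
  else set0.
rewrite (_ : z @^-1` B = \bigcup_m F m); last first.
  apply/seteqP; split => [w Bw|w [m _]].
    exists (pickle (z w)) => //; rewrite /F pickleK; case: asboolP => //.
  rewrite /F; case: (unpickle m) => // k; case: asboolP => // Bk.
  by rewrite /preimage /= => ->.
apply: bigcupT_measurable => m; rewrite /F.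
by case: (unpickle m) => // k; case: asboolP.
Qed.

Section SameLaw.
Context (d : measure_display) (T : measurableType d) (R : realType)
  (P : probability T R).
Context (I : choiceType) (K : countType) (J : nat -> seq I).
Context (J_mono : forall m n, (m <= n)%N -> {subset J m <= J n})
  (J_full : forall i, exists n, i \in J n).
Context (d' : measure_display) (E : measurableType d') (e : K -> E).

(** The null event serves all indices at once, so whole trajectories coincide off it. The extra
    event [B] is the full space for laws and an event on the queue for independence. *)
Lemma trajectory_ae (z : I -> T -> K) (Z : I -> T -> E) (C : set (I -> E)) :
  (forall i k, measurable (z i @^-1` [set k])) ->
  (forall i, measurable_fun setT (Z i)) ->
  {ae P, forall w i, Z i w = e (z i w)} ->
  path_measurable C -> forall B, measurable B ->
  [/\ measurable (trajectory Z @^-1` C),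
      measurable [set w | C (fun i => e (z i w))] &
      P (B `&` trajectory Z @^-1` C) = P (B `&` [set w | C (fun i => e (z i w))])].
Proof.
move=> mz mZ Zz mC B mB.
have m1 : measurable (trajectory Z @^-1` C).
  apply: measurable_trajectory mC => i D mD.
  by rewrite -[X in measurable X]setTI; exact: mZ.
have m2 : measurable [set w | C (fun i => e (z i w))].
  apply: (@measurable_trajectory _ _ T E I (fun i w => e (z i w))) mC => i D mD.
  exact: (@measurable_countable_preimage _ T K (z i) (e @^-1` D)).
split => //; apply: eq_measure_ae; [exact: measurableI|exact: measurableI|].
apply: filterS Zz => w Zw.
suff -> : (B `&` trajectory Z @^-1` C) w =
          (B `&` [set w | C (fun i => e (z i w))]) w by [].
by rewrite /setI /preimage /trajectory /=; congr (_ /\ C _); apply/funext.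
Qed.

Lemma same_law_discrete (z z' : I -> T -> K) (Z Z' : I -> T -> E) :
  (forall i k, measurable (z i @^-1` [set k])) ->
  (forall i k, measurable (z' i @^-1` [set k])) ->
  (forall i, measurable_fun setT (Z i)) -> (forall i, measurable_fun setT (Z' i)) ->
  {ae P, forall w i, Z i w = e (z i w)} ->
  {ae P, forall w i, Z' i w = e (z' i w)} ->
  (forall n v, P (trajectory z @^-1` window J n v) =
               P (trajectory z' @^-1` window J n v)) ->
  same_law P Z Z'.
Proof.
move=> mz mz' mZ mZ' Zz Zz' eq_win C mC.
have [_ _] := trajectory_ae mz mZ Zz mC measurableT.
have [_ _] := trajectory_ae mz' mZ' Zz' mC measurableT.
rewrite !setTI => -> ->.
apply: (@discrete_law _ _ _ P P _ _ _ _ J J_mono J_full z z' mz mz' _ _ e C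
  eq_win mC) => //.
by rewrite ltey_eq fin_num_measure.
Qed.

(** Independence is read as equality of two measures of the same total mass: P restricted to the
    event on [X], and P scaled by the probability of that event. They agree on windows, hence on all
    path events. *)
Lemma independent_discrete (x : T -> K) (z : I -> T -> K) (X : T -> E) (Z : I -> T -> E) :
  (forall k, measurable (x @^-1` [set k])) ->
  (forall i k, measurable (z i @^-1` [set k])) ->
  measurable_fun setT X -> (forall i, measurable_fun setT (Z i)) ->
  {ae P, forall w, X w = e (x w)} ->
  {ae P, forall w i, Z i w = e (z i w)} ->
  (forall n v B, P (trajectory z @^-1` window J n v `&` x @^-1` B) =
               P (trajectory z @^-1` window J n v) * P (x @^-1` B))%E ->
  independent_of_process P X Z.
Proof.
move=> mx mz mX mZ Xx Zz indep B C mB mC.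
have mXB : measurable (X @^-1` B) by rewrite -[X in measurable X]setTI; exact: mX.
have mxB := measurable_countable_preimage (e @^-1` B) mx.
have [mZC mzC eq1] := trajectory_ae mz mZ Zz mC mXB.
have [_ _] := trajectory_ae mz mZ Zz mC measurableT; rewrite !setTI => ->.
rewrite eq1.
have aeX A : measurable A -> P (X @^-1` B `&` A) = P (x @^-1` (e @^-1` B) `&` A).
  move=> mA; apply: eq_measure_ae; [exact: measurableI|exact: measurableI|].
  by apply: filterS Xx => w Xw; rewrite /setI /preimage /= Xw.
rewrite aeX // -[X in (P X * _)%E]setIT aeX // setIT.
have fin : P (x @^-1` (e @^-1` B)) \is a fin_num by rewrite fin_num_measure.
have r0 : 0 <= fine (P (x @^-1` (e @^-1` B))) by rewrite fine_ge0.
pose mu := mrestr P mxB; pose nu := mscale (NngNum r0) P.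
have nuE A : nu A = (P (x @^-1` (e @^-1` B)) * P A)%E by rewrite /nu /mscale /= fineK.
rewrite setIC -nuE.
apply: (@discrete_law _ _ _ mu nu _ _ _ _ J J_mono J_full z z mz mz _ _ e C _ mC) => //.
- by change (P (setT `&` x @^-1` (e @^-1` B)) < +oo)%E; rewrite setTI ltey_eq fin.
- change (P (setT `&` x @^-1` (e @^-1` B)) = nu setT).
  by rewrite nuE probability_setT mule1 setTI.
- by move=> n v; apply: etrans (esym (nuE _)); rewrite muleC -indep.
Qed.

End SameLaw.

Lemma measurable_truncn (R : realType) : measurable_fun setT (@Num.truncn R).
Proof.
move=> _ Y _; rewrite setTI.
have mge k : measurable [set x : R | (k < Num.truncn x)%N].
  rewrite (_ : [set x | _] = `[k.+1%:R, +oo[%classic) //.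
  by apply/seteqP; split => x /=; rewrite in_itv /= andbT truncn_gt_nat.
have mk k : measurable (@Num.truncn R @^-1` [set k]).
  case: k => [|k].
    rewrite (_ : _ @^-1` _ = ~` [set x : R | (0 < Num.truncn x)%N]).
      exact: measurableC.
    by apply/seteqP; split => x /=; [move=> ->|case: (Num.truncn x)].
  rewrite (_ : _ @^-1` _ = [set x : R | (k < Num.truncn x)%N] `\`
                           [set x : R | (k.+1 < Num.truncn x)%N]).
    exact: measurableD.
  apply/seteqP; split => x /=; first by move=> ->; rewrite ltnSn ltnn.
  by move=> [h1 /negP]; rewrite -leqNgt => h2; apply/eqP; rewrite eqn_leq h2.
exact: (measurable_countable_preimage Y mk).
Qed.

Section BerGeomVariable.
Context (d : measure_display) (T : measurableType d) (R : realType)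
  (P : probability T R) (p a : R).

Lemma has_BerGeomE (Z : T -> \bar R) k : has_BerGeom P p a Z ->
  P [set w | Z w = k%:R%:E] = (bergeom p a k)%:E.
Proof. by move=> [_ _ h0 hS]; case: k => [|k] /=; [exact: h0|exact: hS]. Qed.

Context (A : {RV P >-> R}) (A_law : has_BerGeom P p a (EFin \o A)).

Let mA : measurable_fun setT A. Proof. exact: measurable_funPT. Qed.

Let mAk (k : nat) : measurable [set w | A w = k%:R].
Proof.
rewrite (_ : [set w | _] = setT `&` A @^-1` [set k%:R]); last by rewrite setTI.
exact: mA.
Qed.

Let PA k : P [set w | A w = k%:R] = (bergeom p a k)%:E.
Proof.
rewrite -(has_BerGeomE k A_law); congr (P _).
by apply/seteqP; split => w /= [->].
Qed.

Lemma measurable_truncn_RV : measurable_fun setT (fun w => Num.truncn (A w)).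
Proof. exact: (measurableT_comp (@measurable_truncn R) mA). Qed.

(** [has_BerGeom] prescribes only the masses of the natural numbers; these add up to 1, so no mass
    is left elsewhere. *)
Lemma BerGeom_nat_ae : {ae P, forall w, A w = (Num.truncn (A w))%:R}.
Proof.
have [_ ha _ _] := A_law.
exists (~` \bigcup_k [set w | A w = k%:R]); split.
- by apply: measurableC; exact: bigcupT_measurable.
- rewrite probability_setC; last exact: bigcupT_measurable.
  rewrite measure_semi_bigcup //; last exact: bigcupT_measurable.
    rewrite [X in (_ - X)%E](_ : _ = 1%E) ?subee //.
    rewrite -(bergeom_sum p ha); apply: eq_eseriesr => k _; exact: PA.
  apply/trivIsetP => i j _ _ /eqP ij; apply/seteqP; split => // w [/= -> /eqP].
  by rewrite eqr_nat => /eqP.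
- by move=> w /= nA [k _ /= Ak]; apply: nA; rewrite Ak natrK.
Qed.

Lemma BerGeom_truncn_law k :
  P ((fun w => Num.truncn (A w)) @^-1` [set k]) = (bergeom p a k)%:E.
Proof.
rewrite -PA; apply: eq_measure_ae => //.
  by apply: measurable_nat_preimage; exact: measurable_truncn_RV.
apply: filterS BerGeom_nat_ae => w Aw; rewrite /preimage /=; split => [<- //|->].
by rewrite natrK.
Qed.

End BerGeomVariable.

Lemma mass_arrival (R : realType) (p a : R) x y : 0 <= p <= 1 -> 0 < a < 1 ->
  mass (bergeom p a) [set u | (x + u)%N = y] = (@arrival_kernel _ p a x y)%:E.
Proof.
move=> hp ha; rewrite /arrival_kernel; case: leqP => xy.
  rewrite -mass1; last by move=> k; exact: bergeom_ge0.
  by congr (mass _ _); apply/seteqP; split => u /=; lia.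
by apply: mass0 => u /=; lia.
Qed.

Lemma mass_service (R : realType) (q b : R) x y : 0 <= q <= 1 -> 0 < b < 1 ->
  mass (bergeom q b) [set v | (y - v)%N = x] = (@service_kernel _ q b y x)%:E.
Proof.
move=> hq hb; rewrite /service_kernel; case: x => [|x] /=.
  rewrite -bergeom_tail_sum //; apply: eq_eseriesr => k _; congr (_%:E).
  have [h|h] := boolP (y <= k)%N; first by rewrite asboolT //; apply/eqP.
  by rewrite asboolF // => /eqP; rewrite subn_eq0; apply/negP.
case: ltnP => xy.
  transitivity (mass (bergeom q b) [set (y - x.+1)%N]).
    by congr (mass _ _); apply/seteqP; split => u /=; lia.
  by apply: mass1 => k; exact: bergeom_ge0.
by apply: mass0 => u /=; lia.
Qed.

(** * The supremum of net inputs as a limit of queues started empty *)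

Section QueueLength.
Context (d : measure_display) (T : measurableType d) (R : realType)
  (A S : int -> T -> R) (a s : int -> T -> nat) (w : T).
Context (Aa : forall n, A n w = (a n w)%:R) (Ss : forall n, S n w = (s n w)%:R).

Lemma net_inputS (j : nat) n :
  net_input A S (n - j.+1%:Z) n w =
  net_input A S (n - 1 - j%:Z) (n - 1) w + (A (n - 1) w - S (n - 1) w).
Proof.
rewrite /net_input !subKr /= big_ord_recr /=.
have e i : n - j.+1%:Z + i = n - 1 - j%:Z + i by rewrite -[j.+1]addn1 PoszD; ring.
by congr (_ + _); [apply: eq_bigr => i _|]; rewrite e ?subrK.
Qed.

Lemma net_input_le j n :
  net_input A S (n - j%:Z) n w <= (queue_from_empty a s j n w)%:R.
Proof.
elim: j n => [|j IH] n; first by rewrite /net_input subr0 subrr big_ord0.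
rewrite net_inputS Aa Ss /=; apply: (@le_trans _ _
  ((queue_from_empty a s j (n - 1) w + a (n - 1) w)%:R - (s (n - 1) w)%:R)).
  by rewrite natrD addrA lerD2r lerD2r.
by rewrite lerBlDr -natrD ler_nat (addnC (_ - _)%N) -leq_subLR.
Qed.

(** If the last step does not truncate, it adds its increment to the sum already found; if it
    truncates, the empty sum [j = 0] is attained. With [net_input_le], both families have the same
    supremum. *)
Lemma queue_from_empty_net_input N n :
  exists j, (queue_from_empty a s N n w)%:R = net_input A S (n - j%:Z) n w.
Proof.
have net0 m : net_input A S (m - 0%:Z) m w = 0.
  by rewrite /net_input subr0 subrr big_ord0.
elim: N n => [|N IH] n; first by exists 0%N; rewrite net0.
have [j hj] := IH (n - 1).
case: (leqP (s (n - 1) w) (queue_from_empty a s N (n - 1) w + a (n - 1) w)) => h.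
  by exists j.+1; rewrite net_inputS -hj Aa Ss /= natrB // natrD addrA.
by exists 0%N; rewrite net0 /= (eqP (_ : _ - _ == 0)%N) // subn_eq0 ltnW.
Qed.

Lemma queue_length_nat n : queue_finite a s w ->
  queue_length A S n w = ((nat_queue a s n w)%:R)%:E.
Proof.
move=> fin; have qP := nat_queueP (fin n).
apply/eqP; rewrite eq_le; apply/andP; split.
  apply: ge_ereal_sup => _ [m /= mn <-].
  have [j ->] : exists j : nat, m = n - j%:Z.
    by exists `|n - m|%N; rewrite gez0_abs ?subr_ge0 // subKr.
  rewrite lee_fin; apply: le_trans (net_input_le j n) _; rewrite ler_nat -qP.
  by exists j.
have [N hN] : queue_ge a s n (nat_queue a s n w) w by apply/qP.
have [j hj] := queue_from_empty_net_input N n.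
apply: (@le_trans _ _ (net_input A S (n - j%:Z) n w)%:E).
  by rewrite lee_fin -hj ler_nat.
by apply: ereal_sup_ubound; exists (n - j%:Z) => //=; rewrite lerBlDr lerDl.
Qed.

End QueueLength.

(** * Joint law of the truncated inputs *)

Section InputLaw.
Context (d : measure_display) (T : measurableType d) (R : realType)
  (P : probability T R).

(** Independence of the arrival and service processes is stated for sets of paths, so an input event
    has to be split into one such cylinder for each process. *)
Definition truncn_cylinder (n : int) (k : nat) (U : nat -> set nat) : set (int -> R) :=
  [set z | forall i, (i < k)%N -> U i (Num.truncn (z (n + i%:Z)))].

Lemma truncn_cylinder_measurable n k U : path_measurable (truncn_cylinder n k U).
Proof.
rewrite (_ : truncn_cylinder n k U = \bigcap_(i in `I_k)
    (fun z : int -> R => z (n + i%:Z)) @^-1` (@Num.truncn R @^-1` U i)).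
  apply: (@fin_bigcap_measurable _ (g_sigma_algebraType (@cylinders int _ R))).
    exact: finite_II.
  move=> i _; apply: sub_sigma_algebra; exists (n + i%:Z), (@Num.truncn R @^-1` U i).
  by split => //; apply: measurable_nat_preimage; exact: measurable_truncn.
by apply/seteqP; split => z h i /h.
Qed.

Lemma truncn_cylinder_law (A : int -> {RV P >-> R}) (w : nat -> R) n k U :
  mutually_independent P (fun n => A n : T -> R) ->
  (forall n k, P ((fun t => Num.truncn (A n t)) @^-1` [set k]) = (w k)%:E) ->
  P (trajectory (fun n => A n : T -> R) @^-1` truncn_cylinder n k U) =
  (\prod_(i < k) mass w (U i))%E.
Proof.
move=> indep Aw.
pose J := [seq n + i%:Z | i <- iota 0 k].
pose B (j : int) : set R := @Num.truncn R @^-1` U (absz (j - n)%R).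
have absn (i : nat) : absz (n + i%:Z - n)%R = i by rewrite addrC addKr.
transitivity (P (\bigcap_(j in [set` J]) (A j @^-1` B j))).
  congr (P _); apply/seteqP; split => t.
    move=> h j /mapP[i]; rewrite mem_iota add0n => /andP[_ ik] ->.
    by rewrite /B /preimage /= absn; exact: h.
  move=> h i ik; have := h (n + i%:Z); rewrite /B /preimage /= absn; apply.
  by apply/mapP; exists i; rewrite // mem_iota add0n.
rewrite indep; last 2 first.
- rewrite map_inj_uniq ?iota_uniq // => i j /addrI; by case.
- by move=> j; apply: measurable_nat_preimage; exact: measurable_truncn.
rewrite /J big_map -{1}(subn0 k) -/(index_iota 0 k) big_mkord.
apply: eq_bigr => i _; rewrite /B absn.
by apply: (massE (U i) (measurable_truncn_RV (A _))) => j; exact: Aw.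
Qed.

Lemma truncn_input_law (A S : int -> {RV P >-> R}) (wa wb : nat -> R) n k U V :
  mutually_independent P (fun n => A n : T -> R) ->
  mutually_independent P (fun n => S n : T -> R) ->
  independent_processes P (fun n => A n : T -> R) (fun n => S n : T -> R) ->
  (forall n k, P ((fun t => Num.truncn (A n t)) @^-1` [set k]) = (wa k)%:E) ->
  (forall n k, P ((fun t => Num.truncn (S n t)) @^-1` [set k]) = (wb k)%:E) ->
  P (input_event (fun n t => Num.truncn (A n t)) (fun n t => Num.truncn (S n t))
       n k U V) = (\prod_(i < k) (mass wa (U i) * mass wb (V i)))%E.
Proof.
move=> Ai Si AS Aw Sw.
have := AS _ _ (truncn_cylinder_measurable n k U) (truncn_cylinder_measurable n k V).
rewrite (truncn_cylinder_law _ _ _ Ai Aw) (truncn_cylinder_law _ _ _ Si Sw).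
rewrite -big_split /= => <-; congr (P _); apply/seteqP; split => t.
  by move=> h; split => i ik; have [] := h i ik.
by move=> [h1 h2] i ik; split; [exact: h1|exact: h2].
Qed.

End InputLaw.

(** Collects what the stationary queue uses about [c] and [r = 1 - gamma]: the ranges and the
    identities behind detailed balance. *)
Lemma queue_constants (R : realType) (p q alpha beta : R) :
  0 < p < 1 -> 0 < q < 1 -> 0 < alpha < 1 -> 0 < beta < 1 ->
  p * beta < q * alpha ->
  alpha / (1 - alpha) * (p / (1 - p)) = beta / (1 - beta) * (q / (1 - q)) ->
  let c := beta / (1 - beta) * ((1 - alpha) / alpha) in
  let r := (1 - alpha) / (1 - beta) in
  [/\ 0 < c < 1, 0 < r < 1 & (p + c - p * c) * q = p] /\
  [/\ c * alpha = beta * r, (1 - c) * alpha = 1 - r & (1 - beta) * r = 1 - alpha].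
Proof.
move=> /andP[p0 p1] /andP[q0 q1] /andP[a0 a1] /andP[b0 b1] stable balance c r.
have a1' : 0 < 1 - alpha by rewrite subr_gt0.
have b1' : 0 < 1 - beta by rewrite subr_gt0.
have p1' : 0 < 1 - p by rewrite subr_gt0.
have q1' : 0 < 1 - q by rewrite subr_gt0.
have an0 := lt0r_neq0 a0; have bn0 := lt0r_neq0 b0.
have an1 := lt0r_neq0 a1'; have bn1 := lt0r_neq0 b1'.
have pn1 := lt0r_neq0 p1'; have qn1 := lt0r_neq0 q1'.
have bal : alpha * p * ((1 - beta) * (1 - q)) = beta * q * ((1 - alpha) * (1 - p)).
  have -> : alpha * p = alpha / (1 - alpha) * (p / (1 - p)) * ((1 - alpha) * (1 - p)).
    by field; rewrite an1 pn1.
  by rewrite balance; field; rewrite bn1 qn1.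
(* If [alpha <= beta], stability gives [p < q]; the odds of [alpha] and [p] then have a strictly
   smaller product than those of [beta] and [q], against the balance condition. *)
have ba : beta < alpha.
  rewrite ltNge; apply/negP => ab; have pq : p < q.
    rewrite -(ltr_pM2r b0); apply: lt_le_trans stable _.
    by rewrite ler_pM2l.
  have h1 : alpha * (1 - beta) <= beta * (1 - alpha).
    by rewrite !mulrBr !mulr1 (mulrC beta) lerB.
  have h2 : p * (1 - q) < q * (1 - p) by rewrite !mulrBr !mulr1 (mulrC q) ltrD2r.
  have : alpha * (1 - beta) * (p * (1 - q)) < beta * (1 - alpha) * (q * (1 - p)).
    apply: (@le_lt_trans _ _ (beta * (1 - alpha) * (p * (1 - q)))).
      by rewrite ler_wpM2r // mulr_ge0 ?ltW.
    by rewrite ltr_pM2l // mulr_gt0.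
  have -> : beta * (1 - alpha) * (q * (1 - p)) =
            beta * q * ((1 - alpha) * (1 - p)) by ring.
  have -> : alpha * (1 - beta) * (p * (1 - q)) =
            alpha * p * ((1 - beta) * (1 - q)) by ring.
  by rewrite bal ltxx.
have r0 : 0 < r by rewrite divr_gt0.
have r1 : r < 1 by rewrite ltr_pdivrMr // mul1r ltrD2l ltrN2.
have rb : (1 - beta) * r = 1 - alpha by rewrite /r; field.
have ca : c * alpha = beta * r by rewrite /c /r; field; rewrite bn1 an0.
have cna : (1 - c) * alpha = 1 - r by rewrite /c /r; field; rewrite bn1 an0.
have c0 : 0 < c by rewrite mulr_gt0 ?divr_gt0.
have c1 : c < 1.
  rewrite -subr_gt0 -(pmulr_lgt0 _ a0) cna subr_gt0 //.
split; first split; rewrite ?c0 ?c1 ?r0 ?r1 //.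
(* This is the balance condition with [c] inserted; adding [p q] to both sides gives [c' q = p]. *)
have : c * q * (1 - p) = p * (1 - q).
  have -> : c * q * (1 - p) = beta * q * ((1 - alpha) * (1 - p)) / ((1 - beta) * alpha).
    by rewrite /c; field; rewrite bn1 an0.
  by rewrite -bal; field; rewrite bn1 an0.
have -> : (p + c - p * c) * q = c * q * (1 - p) + p * q by ring.
by move=> ->; ring.
Qed.

(** * The stationary queue *)

Section IntWindows.

Definition int_window (N : nat) : seq int := [seq i%:Z - N%:Z | i <- iota 0 N.*2.+1].

Lemma mem_int_window N (j : int) : (j \in int_window N) = (absz j <= N)%N.
Proof.
apply/mapP/idP => [[i]|jN]; first by rewrite mem_iota => iN ->; lia.
by exists (absz (j + N%:Z)%R); [rewrite mem_iota|]; lia.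
Qed.

Lemma int_window_mono m n : (m <= n)%N -> {subset int_window m <= int_window n}.
Proof. by move=> mn i; rewrite !mem_int_window => im; exact: leq_trans mn. Qed.

Lemma int_window_full j : exists N, j \in int_window N.
Proof. by exists (absz j); rewrite mem_int_window. Qed.

Lemma int_windowP (K : Type) N (v x : int -> K) :
  (forall j, j \in int_window N -> x j = v j) <->
  (forall i, (i < N.*2.+1)%N -> x (- N%:Z + i%:Z) = v (- N%:Z + i%:Z)).
Proof.
split => [h i iN|h j /mapP[i]]; first by apply: h; rewrite mem_int_window; lia.
by rewrite mem_iota => /andP[_ iN] ->; rewrite addrC; exact: h.
Qed.

(** The reflection about [m / 2] sends the window from [-N] to [N] onto the one from [m - N] to
    [m + N] and reverses positions, so the backward path starts at [m - N]. *)
Lemma int_window_rev (m : int) N i : (i <= N.*2)%N ->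
  m - N%:Z + (N.*2 - i)%:Z = m - (- N%:Z + i%:Z).
Proof. lia. Qed.

Definition past_window (n : int) (N : nat) : seq {i : int | i < n} :=
  pmap insub [seq n - N%:Z + i%:Z | i <- iota 0 N].

Lemma mem_past_window n N (j : {i : int | i < n}) :
  (j \in past_window n N) = (n - N%:Z <= val j).
Proof.
rewrite mem_pmap_sub; apply/mapP/idP => [[i _ ji]|nj]; first by rewrite ji lerDl.
move: nj (valP j); move: (val j) => m nm mn.
by exists (absz (m - (n - N%:Z))%R); [rewrite mem_iota|]; lia.
Qed.

Lemma past_window_mono n M N : (M <= N)%N ->
  {subset past_window n M <= past_window n N}.
Proof. by move=> MN j; rewrite !mem_past_window; lia. Qed.

Lemma past_window_full n (j : {i : int | i < n}) : exists N, j \in past_window n N.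
Proof. exists (absz (n - val j)%R); rewrite mem_past_window.
by move: (valP j); move: (val j) => m mn; lia. Qed.

(** Translates between paths on the subtype of times before [n] and blocks of consecutive integers
    ending at [n - 1]; the default [v0] is never reached for [i < N]. *)
Lemma past_windowP (K : Type) n N (x : int -> K) (v : {i : int | i < n} -> K) (v0 : K) :
  (forall j, j \in past_window n N -> x (val j) = v j) <->
  (forall i, (i < N)%N -> x (n - N%:Z + i%:Z) =
     if insub (n - N%:Z + i%:Z) is Some j then v j else v0).
Proof.
split => [h i iN|h j].
  case: insubP => [j _ ji|]; last by lia.
  by rewrite -ji; apply: h; rewrite mem_past_window ji lerDl.
rewrite mem_past_window => nj; have jn := valP j.
have := h (absz (val j - (n - N%:Z))%R).
have -> : n - N%:Z + (absz (val j - (n - N%:Z))%R)%:Z = val j.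
  by move: (val j) nj => m nm; lia.
by rewrite valK; apply; move: (val j) nj jn => m nm mn; lia.
Qed.

End IntWindows.

Section StationaryQueue.
Context (d : measure_display) (T : measurableType d) (R : realType)
  (P : probability T R) (p q alpha beta c r : R) (A S : int -> {RV P >-> R}).
Context (hp : 0 < p < 1) (hq : 0 < q < 1)
  (halpha : 0 < alpha < 1) (hbeta : 0 < beta < 1)
  (hc : 0 < c < 1) (hr : 0 < r < 1) (c'q : (p + c - p * c) * q = p)
  (c_alpha : c * alpha = beta * r) (cN_alpha : (1 - c) * alpha = 1 - r)
  (r_beta : (1 - beta) * r = 1 - alpha).
Context (A_indep : mutually_independent P (fun n => A n : T -> R))
  (A_law : forall n, has_BerGeom P p alpha (EFin \o A n))
  (S_indep : mutually_independent P (fun n => S n : T -> R))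
  (S_law : forall n, has_BerGeom P q beta (EFin \o S n))
  (AS_indep : independent_processes P
                (fun n => A n : T -> R) (fun n => S n : T -> R)).

Let a (n : int) (w : T) := Num.truncn (A n w).
Let s (n : int) (w : T) := Num.truncn (S n w).
Let wa := bergeom p alpha.
Let wb := bergeom q beta.
Let H := bergeom_tail c (1 - r).
Let wy := bergeom (p + c - p * c) (1 - r).

Let hr' : 0 < 1 - r < 1.
Proof. by case/andP: hr => r0 r1; rewrite subr_gt0 r1 gtrDl oppr_lt0. Qed.

Let itvW (x : R) : 0 < x < 1 -> 0 <= x <= 1.
Proof. by case/andP => /ltW-> /ltW->. Qed.

Let ma n : measurable_fun setT (a n). Proof. exact: measurable_truncn_RV. Qed.
Let ms n : measurable_fun setT (s n). Proof. exact: measurable_truncn_RV. Qed.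

Let wa_gt0 k : 0 < wa k.
Proof.
case/andP: hp halpha => p0 p1 /andP[a0 a1]; rewrite /wa.
case: k => [|k] /=; first by rewrite subr_gt0.
by rewrite !mulr_gt0 // exprn_gt0 // subr_gt0.
Qed.

Let wb_ge0 k : 0 <= wb k. Proof. by apply: bergeom_ge0 => //; exact: itvW. Qed.
Let wb0 : 0 < wb 0%N. Proof. by rewrite subr_gt0; case/andP: hq. Qed.
Let wa_sum : (\sum_(0 <= k <oo) (wa k)%:E = 1)%E. Proof. exact: bergeom_sum. Qed.
Let wb_sum : (\sum_(0 <= k <oo) (wb k)%:E = 1)%E. Proof. exact: bergeom_sum. Qed.

Let input_law n k U V : P (input_event a s n k U V) =
  (\prod_(i < k) (mass wa (U i) * mass wb (V i)))%E.
Proof.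
apply: truncn_input_law => // m j; exact: BerGeom_truncn_law.
Qed.

Let H0 : H 0%N = 1. Proof. by []. Qed.
Let H_ge0 k : 0 <= H k.
Proof.
case/andP: hc hr => c0 _ /andP[r0 _]; case: k => [|k] //=.
by rewrite mulr_ge0 ?exprn_ge0 // ltW // opprB addrC subrK.
Qed.
Let H_cvg : H @ \oo --> 0. Proof. exact: cvg_bergeom_tail. Qed.

Let HS k : ((H k.+1)%:E = \sum_(0 <= v <oo) (wb v)%:E *
     \sum_(0 <= u <oo) (wa u)%:E * (H (k.+1 + v - u)%N)%:E)%E.
Proof.
rewrite -(@service_tail _ p q alpha beta c r) //.
apply: eq_eseriesr => v _; congr (_ * _)%E.
by rewrite -(@arrival_tail _ p alpha c r).
Qed.

Let qmassE k : qmass H k = bergeom c (1 - r) k. Proof. by rewrite bergeomE. Qed.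

Let balance x y : ((qmass H x)%:E * karr wa x y = (wy y)%:E * ksrv wb y x)%E.
Proof.
rewrite /karr /ksrv mass_arrival ?mass_service ?itvW // qmassE -!EFinM; congr (_%:E).
exact: detailed_balance.
Qed.

Local Notation x := (nat_queue a s).
Local Notation y := (nat_after_arrival a s).
Local Notation X := (queue_length A S).
Local Notation Y := (queue_after_arrival A S).
Local Notation D := (departures A S).

Let nat_ae : {ae P, forall w,
  [/\ forall n, A n w = (a n w)%:R, forall n, S n w = (s n w)%:R & queue_finite a s w]}.
Proof.
have Aae := ae_forall_int (fun n => BerGeom_nat_ae (A_law n)).
have Sae := ae_forall_int (fun n => BerGeom_nat_ae (S_law n)).
have Qae := queue_finite_ae ma ms wa_gt0 wb_ge0 wb0 wa_sum wb_sum input_law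
  H0 H_ge0 H_cvg HS.
by apply: filterS3 Aae Sae Qae => w.
Qed.

Let X_ae : {ae P, forall w n, X n w = ((x n w)%:R)%:E}.
Proof.
by apply: filterS nat_ae => w [Aw Sw fin] n; apply: queue_length_nat.
Qed.

Let Y_ae : {ae P, forall w n, Y n w = ((y n w)%:R)%:E}.
Proof.
apply: filterS nat_ae => w [Aw Sw fin] n.
by rewrite /queue_after_arrival (queue_length_nat Aw Sw) // Aw -EFinD -natrD.
Qed.

Let D_ae : {ae P, forall w n, D n w = ((nat_departures a s n w)%:R)%:E}.
Proof.
apply: filterS2 nat_ae Y_ae => w [Aw Sw fin] Yw n.
by rewrite /departures Yw Sw -EFin_min -natr_min.
Qed.

Let mX n : measurable_fun setT (X n).
Proof.
(* With [j = n - m] the supremum runs over a sequence, and [esups] from index 0 is measurable. *)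
pose u (j : nat) w := (net_input A S (n - j%:Z) n w)%:E.
rewrite (_ : X n = fun w => esups (u ^~ w) 0).
  apply: measurable_fun_esups => j; apply/measurable_EFinP.
  rewrite /net_input; apply: measurable_sum => i.
  by apply: measurable_funB; exact: measurable_funPT.
apply/funext => w; rewrite /queue_length /esups /=; congr (ereal_sup _).
apply/seteqP; split => _ [m /= mn <-].
  exists (absz (n - m)%R) => //; rewrite /u; congr ((net_input _ _ _ _ _)%:E).
  by rewrite gez0_abs ?subr_ge0 // subKr.
by exists (n - m%:Z) => //=; rewrite lerBlDr lerDl.
Qed.

Let mY n : measurable_fun setT (Y n).
Proof.
apply: emeasurable_funD => //; apply/measurable_EFinP; exact: measurable_funPT.
Qed.

Let mD n : measurable_fun setT (D n).
Proof.
apply: measurable_mine => //; apply/measurable_EFinP; exact: measurable_funPT.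
Qed.

Let mx n B : measurable (x n @^-1` B).
Proof. by apply: measurable_nat_preimage; exact: measurable_nat_queue. Qed.

Let my n B : measurable (y n @^-1` B).
Proof. by apply: measurable_nat_preimage; exact: measurable_nat_after_arrival. Qed.

Let mdep n B : measurable (nat_departures a s n @^-1` B).
Proof. by apply: measurable_nat_preimage; exact: measurable_nat_departures. Qed.

Let mxy m n (k : nat * nat) :
  measurable ((fun w => (x m w, y n w)) @^-1` [set k]).
Proof.
rewrite (_ : _ @^-1` _ = x m @^-1` [set k.1] `&` y n @^-1` [set k.2]).
  exact: measurableI.
by case: k => k l; apply/seteqP; split => w; rewrite /setI /preimage /= => -[-> ->].
Qed.

(** One reflection of the half-step chain serves three statements: [m = -1] sends X_n to X_{-n},
    while [m = 0] sends Y_n to Y_{-n} and gives the joint form. The map [e] selects the observed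
    coordinates. *)
Lemma queue_same_law_reversed (d' : measure_display) (E : measurableType d')
    (e : nat * nat -> E) (m : int) (Z Z' : int -> T -> E) :
  (forall n, measurable_fun setT (Z n)) -> (forall n, measurable_fun setT (Z' n)) ->
  {ae P, forall w n, Z n w = e (x n w, y n w)} ->
  {ae P, forall w n, Z' n w = e (x (m + 1 - n) w, y (m - n) w)} ->
  same_law P Z Z'.
Proof.
move=> mZ mZ' Zae Z'ae.
apply: (same_law_discrete int_window_mono int_window_full
  (z := fun n w => (x n w, y n w)) (z' := fun n w => (x (m + 1 - n) w, y (m - n) w))
  _ _ mZ mZ' Zae Z'ae) => [n k|n k|N v]; try exact: mxy.
transitivity (P (forward_path a s (- N%:Z) N.*2 (fun i => v (- N%:Z + i%:Z)))).
  congr (P _); apply/seteqP; split => w.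
    by move=> /int_windowP h i iN; rewrite -(h i iN).
  move=> h; apply/int_windowP => i iN; have [] := h i iN.
  by rewrite /trajectory => -> ->; case: (v _).
rewrite (path_reversal ma ms wa_gt0 wb_ge0 wb0 wa_sum wb_sum input_law H0 H_ge0
  H_cvg HS balance _ (m - N%:Z)).
congr (P _); apply/seteqP; split => w.
  move=> h; apply/int_windowP => i iN; rewrite /trajectory.
  have := h (N.*2 - i)%N (leq_subr _ _); rewrite subKn //.
  rewrite int_window_rev // (addrAC m 1).
  by case=> -> ->; case: (v _).
move=> /int_windowP h i iN.
have := h (N.*2 - i)%N; rewrite ltnS leq_subr => /(_ isT); rewrite /trajectory.
rewrite (addrAC m 1) -int_window_rev ?leq_subr // subKn //.
by move=> <-.
Qed.

Lemma queue_length_reversible : reversible P X.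
Proof.
apply: (@queue_same_law_reversed _ _ (fun k => (k.1%:R)%:E) (- 1)) => //.
by apply: filterS X_ae => w Xw n; rewrite Xw addNr sub0r.
Qed.

Lemma queue_after_arrival_reversible : reversible P Y.
Proof.
apply: (@queue_same_law_reversed _ _ (fun k => (k.2%:R)%:E) 0) => //.
by apply: filterS Y_ae => w Yw n; rewrite Yw sub0r.
Qed.

Lemma queue_jointly_reversible :
  same_law P (fun (n : int) w => (X n w, Y n w))
             (fun (n : int) w => (X (1 - n) w, Y (- n) w)).
Proof.
apply: (@queue_same_law_reversed _ _
  (fun k => ((k.1%:R)%:E, (k.2%:R)%:E)) 0) => [n|n||].
- exact: measurable_fun_pair.
- exact: measurable_fun_pair.
- by apply: filterS2 X_ae Y_ae => w Xw Yw n; rewrite Xw Yw.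
- by apply: filterS2 X_ae Y_ae => w Xw Yw n; rewrite Xw Yw add0r sub0r.
Qed.

Lemma departures_same_law : same_law P D (fun n => EFin \o A n).
Proof.
apply: (same_law_discrete int_window_mono int_window_full
  (e := fun k : nat => (k%:R)%:E) (z := nat_departures a s) (z' := a)) => //.
- by move=> n k; apply: measurable_nat_preimage.
- by move=> n; apply/measurable_EFinP; exact: measurable_funPT.
- by apply: filterS nat_ae => w [Aw _ _] n; rewrite /= Aw.
move=> N v.
transitivity (P (departure_path a s (- N%:Z) N.*2.+1 (fun i => v (- N%:Z + i%:Z)))).
  congr (P _); apply/seteqP; split => w.
    by move=> /int_windowP h i; exact: h.
  by move=> h; apply/int_windowP => i; exact: h.
rewrite (departure_path_law ma ms wa_gt0 wb_ge0 wb0 wa_sum wb_sum input_law H0 H_ge0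
  H_cvg HS balance).
have := arrival_path_law wa_gt0 wb_sum input_law (- N%:Z) N.*2.+1
  (fun i => v (- N%:Z + i%:Z)).
move=> /= <-.
congr (P _); apply/seteqP; split => w.
  by move=> h; apply/int_windowP => i; exact: h.
by move=> /int_windowP h i; exact: h.
Qed.

Lemma queue_length_law n : has_BerGeom P c (1 - r) (X n).
Proof.
have law k : P [set w | X n w = (k%:R)%:E] = (bergeom c (1 - r) k)%:E.
  rewrite -qmassE -(nat_queue_law ma ms wa_gt0 wb_ge0 wb0 wa_sum wb_sum input_law H0
    H_ge0 H_cvg HS n); apply: eq_measure_ae => //.
    by have := mX n measurableT (emeasurable_set1 (k%:R)%:E); rewrite setTI.
  apply: filterS X_ae => w Xw; rewrite /preimage /= Xw.
  by split => [[/eqP]|->//]; rewrite eqr_nat => /eqP.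
split => //; [exact: itvW|exact: law 0%N|].
by case=> // k _; exact: law k.+1.
Qed.

Lemma queue_after_arrival_law n : has_BerGeom P (p + c - p * c) (1 - r) (Y n).
Proof.
have law k : P [set w | Y n w = (k%:R)%:E] = (bergeom (p + c - p * c) (1 - r) k)%:E.
  rewrite -[RHS](nat_after_arrival_law ma ms wa_gt0 wb_ge0 wb0 wa_sum wb_sum input_law H0
    H_ge0 H_cvg HS balance n); apply: eq_measure_ae => //.
    by have := mY n measurableT (emeasurable_set1 (k%:R)%:E); rewrite setTI.
  apply: filterS Y_ae => w Yw; rewrite /preimage /= Yw.
  by split => [[/eqP]|->//]; rewrite eqr_nat => /eqP.
split => //; [|exact: law 0%N|by case=> // k _; exact: law k.+1].
have -> : p + c - p * c = 1 - (1 - p) * (1 - c) by ring.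
case/andP: hp hc => p0 p1 /andP[c0 c1].
have [p' c'] : 0 <= 1 - p <= 1 /\ 0 <= 1 - c <= 1.
  by rewrite !subr_ge0 !gerBl !ltW.
case/andP: p' c' => pp0 pp1 /andP[cc0 cc1].
by rewrite subr_ge0 gerBl mulr_ge0 // mulr_ile1.
Qed.

Lemma queue_length_departures_indep (n : int) :
  independent_of_process P (X n) (fun i : {i : int | i < n} => D (val i)).
Proof.
apply: (independent_discrete (@past_window_mono n) (@past_window_full n)
  (e := fun k : nat => (k%:R)%:E) (x := x n)
  (z := fun (i : {i : int | i < n}) => nat_departures a s (val i))) => //.
- by apply: filterS X_ae => w.
- by apply: filterS D_ae => w Dw i; rewrite Dw.
move=> N v B.
pose v' (i : nat) : nat := if insub (n - N%:Z + i%:Z) is Some j then v j else 0%N.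
have -> : trajectory (fun i : {i : int | i < n} => nat_departures a s (val i))
    @^-1` window (past_window n) N v = departure_path a s (n - N%:Z) N v'.
  apply/seteqP; split => w h.
    exact: (@past_windowP _ n N (nat_departures a s ^~ w) v 0%N).1.
  exact: (@past_windowP _ n N (nat_departures a s ^~ w) v 0%N).2.
have := departure_queue_indep ma ms wa_gt0 wb_ge0 wb0 wa_sum wb_sum input_law H0 H_ge0
  H_cvg HS balance (n - N%:Z) N v' B.
by rewrite subrK.
Qed.

End StationaryQueue.

Unset Implicit Arguments.

Theorem theorem4p1 (d : measure_display) (T : measurableType d) (R : realType)
    (P : probability T R) (p q alpha beta : R)
    (A S : int -> {RV P >-> R})
    (hp : 0 < p < 1) (hq : 0 < q < 1)
    (halpha : 0 < alpha < 1) (hbeta : 0 < beta < 1)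
    (A_indep : mutually_independent P (fun n => A n : T -> R))
    (A_law : forall n, has_BerGeom P p alpha (EFin \o A n))
    (S_indep : mutually_independent P (fun n => S n : T -> R))
    (S_law : forall n, has_BerGeom P q beta (EFin \o S n))
    (AS_indep : independent_processes P
                  (fun n => A n : T -> R) (fun n => S n : T -> R))
    (stable : p * beta < q * alpha)
    (balance : alpha / (1 - alpha) * (p / (1 - p)) =
               beta / (1 - beta) * (q / (1 - q))) :
  let X := queue_length A S in
  let Y := queue_after_arrival A S in
  let D := departures A S in
  let c := beta / (1 - beta) * ((1 - alpha) / alpha) in
  let gamma := (alpha - beta) / (1 - beta) in
  [/\ [/\ reversible P X,
          reversible P Y &
          same_law P (fun (n : int) w => (X n w, Y n w))
                     (fun (n : int) w => (X (1 - n) w, Y (- n) w))],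
      same_law P D (fun n => EFin \o A n),
      forall n : int, has_BerGeom P c gamma (X n) /\
                      has_BerGeom P (p + c - p * c) gamma (Y n) &
      forall n : int, independent_of_process P (X n)
        (fun i : {i : int | i < n} => D (val i))].
Proof.
move=> X Y D c gamma.
have [[hc hr c'q] [c_alpha cN_alpha r_beta]] :=
  queue_constants hp hq halpha hbeta stable balance.
(* The stationary laws were obtained with parameter [1 - r]. *)
have -> : gamma = 1 - (1 - alpha) / (1 - beta).
  have b1 : 1 - beta != 0 by case/andP: hbeta => _; rewrite -subr_gt0 => /lt0r_neq0.
  by rewrite -[X in X - _](divff b1) -mulrBl; congr (_ / _); ring.
split; [split| | |].
- exact: (queue_length_reversible hp hq halpha hbeta hc hr c'q c_alpha
    cN_alpha r_beta A_indep A_law S_indep S_law AS_indep).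
- exact: (queue_after_arrival_reversible hp hq halpha hbeta hc hr c'q c_alpha
    cN_alpha r_beta A_indep A_law S_indep S_law AS_indep).
- exact: (queue_jointly_reversible hp hq halpha hbeta hc hr c'q c_alpha
    cN_alpha r_beta A_indep A_law S_indep S_law AS_indep).
- exact: (departures_same_law hp hq halpha hbeta hc hr c'q c_alpha
    cN_alpha r_beta A_indep A_law S_indep S_law AS_indep).
- move=> n; split.
    exact: (queue_length_law hp hq halpha hbeta hc hr c'q c_alpha
      cN_alpha r_beta A_indep A_law S_indep S_law AS_indep).
  exact: (queue_after_arrival_law hp hq halpha hbeta hc hr c'q c_alpha
    cN_alpha r_beta A_indep A_law S_indep S_law AS_indep).
- move=> n.
  exact: (queue_length_departures_indep hp hq halpha hbeta hc hr c'q c_alpha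
    cN_alpha r_beta A_indep A_law S_indep S_law AS_indep).
Qed.
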